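(* Suppose that $1\le k\le n/2$ with $q$ a fixed prime power. If $k\to\infty$, the proportion of elements of $GL(n,q)$ which are derangements on $k$-spaces tends to $1$. More precisely, there are universal constants $A,B$ (independent of $n$, $k$, $q$, $\epsilon$) such that for any $\epsilon>0$ and any $k$ with $k>B/\sqrt{\epsilon}$, the proportion of elements of $GL(n,q)$ which are derangements on $k$-spaces is at least $$1-\epsilon-\frac{A}{\epsilon\,(k-B/\sqrt{\epsilon})^{.01}}.$$
   Context: An element of $GL(n,q)$ is a derangement on $k$-spaces if it leaves invariant no $k$-dimensional subspace of $\mathbb{F}_q^n$. *)

(* Defs.v *)
From mathcomp Require Import all_boot all_order all_algebra all_fingroup.
From mathcomp Require Import all_classical all_reals all_analysis.

Set Implicit Arguments.
Unset Strict Implicit.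
Unset Printing Implicit Defensive.

Import Order.TTheory GRing.Theory Num.Theory.
Import numFieldNormedType.Exports.

Local Open Scope ring_scope.

(* Subspaces of F^n are the row spaces of n x n matrices, on which g acts by
   right multiplication; n = 0 is degenerate because {'GL_n[F]} consists of
   matrices of size n.-1.+1. *)
Definition derangement_on_spaces (F : finFieldType) (n k : nat)
    (g : {'GL_n[F]}) : bool :=
  [forall U : 'M[F]_n.-1.+1, (\rank U == k) ==> ~~ stablemx U (GLval g)].

Definition derangement_proportion (R : realType) (F : finFieldType)
    (n k : nat) : R :=
  #|[set g in ('GL_n[F])%g | derangement_on_spaces k g]|%:R / #|('GL_n[F])%g|%:R.

(* Main.v *)
Require Import Defs.
From mathcomp Require Import all_boot all_order all_algebra all_fingroup.
From mathcomp Require Import all_classical all_reals all_analysis.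
From mathcomp Require Import zify ring lra.

(* Erdos' multiplication table argument.  Let Omega g be the number, counted with
   multiplicity, of irreducible factors of the characteristic polynomial of g
   whose degree lies between 8 and K = k / 2.  It is typically about log K, but
   if g fixes a k-space U then it is the sum of the counts for g on U and on the
   quotient, each of which is typically about log K.  With x = (4/3)^Omega / K^(7/16)
   and N the number of fixed k-spaces, 1 <= x + N / x as soon as N >= 1, and N / x
   averages to K^(7/16) times the product of the means of (3/4)^Omega over GL_k
   and GL_(n-k).  These means are O(K^(-1/4)), that of (4/3)^Omega over GL_n is
   O(K^(3/8)), so the proportion of g fixing a k-space is O(K^(-1/16)), uniformly
   in n and q.  The theorem asks for much less, with B = 0: by AM-GM
   eps + A / (eps k^(1/100)) >= 2 sqrt(A) k^(-1/200).

   The means over GL_n reduce to means over monic polynomials because, for a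
   monic f of degree at most n, at most |GL_n| pairs (g, v) have f as the
   annihilator of v under g.  Writing q^j s_j for the sum of w^Omega over monic
   polynomials of degree j, the identity deg f = sum of deg p over the prime
   powers p^i dividing f turns into a recursion expressing j s_j through
   s_0, ..., s_(j-1). *)

Set Implicit Arguments.
Unset Strict Implicit.
Unset Printing Implicit Defensive.

Import Order.TTheory GRing.Theory Num.Theory.
Import numFieldNormedType.Exports.

Local Open Scope ring_scope.

(** * Monic polynomials over a finite field *)

Section Monic.
Variable F : finFieldType.
Implicit Types (f h p : {poly F}).

Definition monics (j : nat) : seq {poly F} := [seq 'X^j + rVpoly v | v : 'rV[F]_j].

Lemma mem_monics j f : (f \in monics j) = (f \is monic) && (size f == j.+1).
Proof.
apply/mapP/andP => [[v _ ->]|[fm /eqP sf]].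
  have sv : (size (rVpoly v) < size ('X^j : {poly F}))%N.
    by rewrite size_polyXn ltnS size_poly.
  by rewrite monicE lead_coefDl // lead_coefXn size_polyDl // size_polyXn !eqxx.
exists (poly_rV (f - 'X^j)); first by rewrite mem_enum.
rewrite poly_rV_K ?subrKC //.
have sle : (size (f - 'X^j)%R <= j.+1)%N.
  by rewrite (leq_trans (size_polyD _ _)) // size_polyN size_polyXn sf maxnn.
apply/leq_sizeP => i; rewrite leq_eqVlt => /predU1P [<-|lt_ji]; last first.
  by apply: nth_default; rewrite (leq_trans sle).
move: fm; rewrite monicE /lead_coef sf /= => /eqP e.
by rewrite coefB coefXn eqxx e subrr.
Qed.

Lemma uniq_monics j : uniq (monics j).
Proof.
rewrite map_inj_uniq ?enum_uniq // => u v /addrI /(congr1 (@poly_rV _ j)).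
by rewrite !rVpolyK.
Qed.

Lemma size_monics j : size (monics j) = (#|F| ^ j)%N.
Proof. by rewrite size_map -cardE card_mx mul1n. Qed.

Lemma sum_monics_dvd (R : nmodType) j m c (G : {poly F} -> R) :
  c \in monics m -> (m <= j)%N ->
  \sum_(f <- monics j | c %| f) G f = \sum_(h <- monics (j - m)) G (c * h).
Proof.
rewrite mem_monics => /andP[cm /eqP sc] le_mj.
have c0 : c != 0 by exact: monic_neq0.
rewrite -[LHS]big_filter -[RHS](big_map (fun h => c * h) xpredT).
apply/perm_big/uniq_perm.
- by rewrite filter_uniq ?uniq_monics.
- by rewrite map_inj_uniq ?uniq_monics //; apply: mulfI.
move=> f; rewrite mem_filter mem_monics.
apply/andP/mapP => [[/dvdpP[h ->]]|[h]].
  move=> /andP[fm /eqP sf]; exists h; last by rewrite mulrC.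
  rewrite mem_monics; move: fm; rewrite monicMr // => hm; rewrite hm /=.
  apply/eqP; move: sf; rewrite size_Mmonic ?monic_neq0 // sc; move: (size h) => a; lia.
rewrite mem_monics => /andP[hm /eqP sh] ->; rewrite dvdp_mulr //; split => //.
rewrite monicMr //; apply/andP; split=> //.
by rewrite size_Mmonic ?monic_neq0 // sc sh; apply/eqP; lia.
Qed.

Lemma monics_dvd0 (R : nmodType) j m c (G : {poly F} -> R) :
  c \in monics m -> (j < m)%N -> \sum_(f <- monics j | c %| f) G f = 0.
Proof.
rewrite mem_monics => /andP[cm /eqP sc] lt_jm.
rewrite big_seq_cond big1 // => f; rewrite mem_monics => /andP[/andP[fm /eqP sf]].
by move/dvdp_leq => /(_ (monic_neq0 fm)); rewrite sf sc ltnS leqNgt lt_jm.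
Qed.

Lemma Euclid_dvdp p f h : irreducible_poly p -> (p %| f * h) = (p %| f) || (p %| h).
Proof.
move=> ip; have [pf|npf] := boolP (p %| f); first by rewrite dvdp_mulr.
by rewrite /= Gauss_dvdpr // irreducible_poly_coprime.
Qed.

(** Counting the exponents [i >= 1] with [p ^+ i %| f] lets sums over [f] be exchanged with sums
    over the prime powers [p ^+ i]. *)
Definition mult p f : nat := (\sum_(1 <= i < size f) (p ^+ i %| f)%R)%N.

Lemma mult_decomp p f : irreducible_poly p -> f != 0 ->
  exists a g, f = p ^+ a * g /\ ~~ (p %| g).
Proof.
move=> [sp _]; elim/ltn_ind: {f}(size f) {-2}f (erefl (size f)) => n IHn f sf f0.
have [/dvdpP[g eg]|npf] := boolP (p %| f); last by exists 0%N, f; rewrite expr0 mul1r.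
move: f0; rewrite eg mulf_eq0 negb_or => /andP[g0 p0].
have lt_gn : (size g < n)%N.
  rewrite -sf eg size_mul //; move: g0 sp; rewrite -size_poly_gt0.
  by move: (size g) (size p) => x y; lia.
have [a [g' [eg' ng']]] := IHn _ lt_gn g (erefl _) g0.
by exists a.+1, g'; split=> //; rewrite {1}eg' exprSr mulrAC.
Qed.

Lemma multE p a g : irreducible_poly p -> ~~ (p %| g) -> mult p (p ^+ a * g) = a.
Proof.
move=> ip npg.
have p0 := irredp_neq0 ip; have sp : (1 < size p)%N by case: ip.
have g0 : g != 0 by apply: contraNneq npg => ->; rewrite dvdp0.
have dvdE i : (p ^+ i %| p ^+ a * g) = (i <= a)%N.
  have [le_ia|lt_ai] := leqP i a; first by rewrite dvdp_mulr // dvdp_exp2l.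
  rewrite -(subnKC (ltnW lt_ai)) exprD dvdp_mul2l ?expf_neq0 //.
  apply: contraNF npg => /(dvdp_trans _); apply.
  by rewrite -{1}[p]expr1 dvdp_exp2l // subn_gt0.
have lt_as : (a < size (p ^+ a * g)%R)%N.
  rewrite size_mul ?expf_neq0 // ltn_predRL.
  have : (a < size (p ^+ a)%R)%N.
    have := size_poly_gt0 (p ^+ a); rewrite expf_neq0 // => sa.
    by rewrite -(prednK sa) size_exp ltnS leq_pmull // -ltnS prednK // ltnW.
  by move=> lt_a; have := g0; rewrite -size_poly_gt0; move: (size g) (size _) lt_a => x y; lia.
rewrite /mult (eq_bigr (fun i => (i <= a)%N : nat)); last by move=> i _; rewrite dvdE.
rewrite (@big_cat_nat _ _ _ a.+1) //= big_nat (eq_bigr (fun=> 1%N)); last first.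
  by move=> i /andP[_]; rewrite ltnS => ->.
rewrite -big_nat sum_nat_const_nat muln1 subn1 /= big_nat big1 ?addn0 // => i /andP[].
by rewrite ltnNge => /negPf->.
Qed.

Lemma multM p f h : irreducible_poly p -> f != 0 -> h != 0 ->
  mult p (f * h) = (mult p f + mult p h)%N.
Proof.
move=> ip f0 h0.
have [a [f' [-> nf]]] := mult_decomp ip f0.
have [b [h' [-> nh]]] := mult_decomp ip h0.
rewrite mulrACA -exprD !multE // Euclid_dvdp // negb_or nf //.
Qed.

Lemma mult_irred p r : irreducible_poly p -> irreducible_poly r ->
  p \is monic -> r \is monic -> mult p r = (p == r).
Proof.
move=> ip ir pm rm; have [->|npr] := eqVneq p r.
  have := @multE r 1%N 1 ir; rewrite expr1 mulr1; apply.
  by rewrite dvdp1; case: ir => s _; rewrite neq_ltn s orbT.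
have := @multE p 0%N r ip; rewrite expr0 mul1r; apply.
apply: contra npr => pr; rewrite -eqp_monic //.
by case: ir => _; apply=> //; case: ip => s _; rewrite neq_ltn s orbT.
Qed.

Lemma mult1 p : mult p 1 = 0%N.
Proof. by rewrite /mult size_poly1 big_geq. Qed.

Lemma mult_monics p f j : f \in monics j ->
  mult p f = (\sum_(1 <= i < j.+1) (p ^+ i %| f)%R)%N.
Proof. by rewrite mem_monics /mult => /andP[_ /eqP->]. Qed.

Definition primes_deg d : seq {poly F} := [seq p <- monics d | irreducibleb p].

Lemma mem_primes_deg d p : reflect
  [/\ irreducible_poly p, p \is monic & size p = d.+1] (p \in primes_deg d).
Proof.
rewrite mem_filter mem_monics; apply: (iffP and3P) => -[].
  by move=> /irreducibleP ip pm /eqP sp; split.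
by move=> /irreducibleP ip pm /eqP sp; split.
Qed.

Lemma exists_irred_dvdp f : (1 < size f)%N ->
  exists2 p, irreducible_poly p /\ p \is monic & p %| f.
Proof.
have [n] := ubnP (size f); elim: n f => // n IHn f; rewrite ltnS => le_sf sf.
have f0 : f != 0 by rewrite -size_poly_gt0 ltnW.
have lc0 : (lead_coef f)^-1 != 0 by rewrite invr_eq0 lead_coef_eq0.
have [/irreducibleP if_|] := boolP (irreducibleb f).
  exists ((lead_coef f)^-1 *: f); last by rewrite dvdpZl.
  split; last by rewrite monicE lead_coefZ mulVf // lead_coef_eq0.
  split; first by rewrite size_scale.
  move=> g sg; rewrite dvdpZr // => gf.
  by rewrite (eqp_trans (if_ g sg gf)) // eqp_sym eqp_scale.
rewrite /irreducibleb sf /= => /forallPn[g].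
rewrite negb_imply -ltnNge => /andP[gf sg].
have lt_gn : (size g < n)%N.
  by apply: leq_trans le_sf; apply: leq_ltn_trans (size_npoly g) _; rewrite ltn_predL ltnW.
have [p ip pg] := IHn (val g) lt_gn sg.
by exists p => //; apply: dvdp_trans pg _; rewrite Pdiv.Idomain.dvdpE.
Qed.

(** Unique factorization read off in degrees. Splitting off one monic irreducible divisor [r] raises
    both sides by its degree, because [mult p] is additive and [mult p r] is nonzero only for
    [p = r]. *)
Lemma sum_mult D f : f \is monic -> (size f <= D.+1)%N ->
  (\sum_(1 <= d < D.+1) \sum_(p <- primes_deg d) d * mult p f)%N = (size f).-1.
Proof.
have [n] := ubnP (size f); elim: n f => // n IHn f; rewrite ltnS => le_sf fm.
have f0 := monic_neq0 fm.
have [le_f1 _|lt_1f] := leqP (size f) 1.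
  have -> : f = 1.
    apply/eqP; rewrite -eqp_monic ?monic1 // -size_poly_eq1 eqn_leq le_f1.
    by rewrite size_poly_gt0.
  rewrite size_poly1 big1 // => d _.
  by rewrite big1 // => p _; rewrite mult1 muln0.
have [r [ir rm] /dvdpP[h eh]] := exists_irred_dvdp lt_1f.
move: f0 fm lt_1f le_sf; rewrite eh mulf_eq0 negb_or => /andP[h0 r0].
rewrite monicMr // size_mul // => hm lt_1f le_sf.
have sr : (1 < size r)%N by case: ir.
have sh : (0 < size h)%N by rewrite size_poly_gt0.
have lt_hn : (size h < n)%N.
  by move: sh sr le_sf; move: (size h) (size r) => x y; lia.
move=> le_nD.
have le_hD : (size h <= D.+1)%N.
  by move: sh sr le_nD; move: (size h) (size r) => x y; lia.
have -> : (size h + size r).-1.-1 = ((size h).-1 + (size r).-1)%N.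
  by move: sh sr; move: (size h) (size r) => x y; lia.
rewrite -(IHn _ lt_hn hm le_hD).
rewrite (eq_bigr (fun d => (\sum_(p <- primes_deg d) d * mult p h) +
   \sum_(p <- primes_deg d) d * (p == r)))%N; last first.
  move=> d _; rewrite -big_split; apply: eq_big_seq => p /mem_primes_deg[ip pm _].
  by rewrite multM // mulnDr (mult_irred ip ir).
rewrite big_split; congr (_ + _)%N.
have le_rD : ((size r).-1 < D.+1)%N.
  by move: sh sr le_nD; move: (size h) (size r) => x y; lia.
rewrite (bigD1_seq (size r).-1) ?iota_uniq //=; last first.
  by rewrite mem_index_iota le_rD andbT -ltnS prednK // ltnW.
rewrite (bigD1_seq r) ?filter_uniq ?uniq_monics //=; last first.
  by apply/mem_primes_deg; split; rewrite // prednK // ltnW.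
rewrite eqxx muln1 big1 => [|p /negPf->]; last by rewrite muln0.
rewrite addn0 big1 ?addn0 // => d nd.
rewrite big_seq big1 // => p /mem_primes_deg[_ _ sp].
by case: eqP => [epr|]; rewrite ?muln0 //; rewrite -epr sp eqxx in nd.
Qed.

End Monic.

(** * The count Omega and the recursion for its weighted sums *)

Section Omega.
Variables (F : finFieldType) (lo hi : nat).
Implicit Types (f h p : {poly F}).

Definition Omega f : nat :=
  (\sum_(lo <= d < hi.+1) \sum_(p <- primes_deg F d) mult p f)%N.

Lemma OmegaM f h : f != 0 -> h != 0 -> Omega (f * h) = (Omega f + Omega h)%N.
Proof.
move=> f0 h0; rewrite /Omega -big_split; apply: eq_bigr => d _.
rewrite -big_split; apply: eq_big_seq => p /mem_primes_deg[ip _ _].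
exact: multM.
Qed.

Lemma Omega1 : Omega 1 = 0%N.
Proof. by rewrite /Omega big1 // => d _; rewrite big1 // => p _; exact: mult1. Qed.

Lemma OmegaX f i : f != 0 -> Omega (f ^+ i) = (i * Omega f)%N.
Proof.
move=> f0; elim: i => [|i IH]; first by rewrite expr0 Omega1.
by rewrite exprS OmegaM ?expf_neq0 // IH mulSn.
Qed.

Lemma Omega_irred d p : p \in primes_deg F d -> Omega p = (lo <= d <= hi)%N.
Proof.
move=> pd; have /mem_primes_deg[ip pm sp] := pd.
rewrite /Omega; transitivity (\sum_(lo <= e < hi.+1) (e == d))%N.
  apply: eq_bigr => e _.
  rewrite (eq_big_seq (fun r => (r == p) : nat)); last first.
    by move=> r /mem_primes_deg[ir rm _]; rewrite mult_irred.
  have [->|ned] := eqVneq e d.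
    rewrite (bigD1_seq p) ?filter_uniq ?uniq_monics //= eqxx big1 // => r.
    by move=> /negPf->.
  rewrite big_seq big1 // => r /mem_primes_deg[_ _ sr].
  by case: eqP => // erp; move: sr ned; rewrite erp sp => -[->]; rewrite eqxx.
have [din|dout] := boolP (lo <= d <= hi)%N.
  rewrite (bigD1_seq d) ?iota_uniq ?mem_index_iota //= eqxx big1 // => e.
  by move=> /negPf->.
rewrite big_nat big1 // => e ein; case: eqP => // eed.
by move: dout; rewrite -eed -ltnS ein.
Qed.

(** By [sum_mult] the degree counts each irreducible factor with weight [d], and [d >= 1] on the
    range of [Omega]. The bound [D] covers both [hi] and the degree of [f]. *)
Lemma Omega_le_deg f : (0 < lo)%N -> f \is monic -> (Omega f <= (size f).-1)%N.
Proof.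
move=> lo0 fm; set D := maxn (size f) hi.
rewrite -(@sum_mult F D) //; last by rewrite leqW // leq_maxl.
have [le_hl|lt_lh] := leqP hi.+1 lo; first by rewrite /Omega big_geq.
have le_hD : (hi.+1 <= D.+1)%N by rewrite ltnS leq_maxr.
rewrite (@big_cat_nat _ _ _ lo 1 D.+1) // ?(leq_trans (ltnW lt_lh)) //=.
apply: leq_trans (leq_addl _ _).
rewrite (@big_cat_nat _ _ _ hi.+1 lo D.+1) ?(ltnW lt_lh) //=.
apply: leq_trans (leq_addr _ _).
rewrite /Omega big_nat [X in (_ <= X)%N]big_nat; apply: leq_sum => d /andP[le_d _].
by apply: leq_sum => p _; rewrite leq_pmull // (leq_trans lo0).
Qed.

Variable R : realFieldType.
Implicit Types w : R.

Definition Omega_sum w j : R := \sum_(f <- monics F j) w ^+ Omega f.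

(** The value of [w ^+ Omega p] at a monic irreducible [p] of degree [d]. *)
Definition Omega_wt w d : R := if (lo <= d <= hi)%N then w else 1.

(** Coefficientwise, the logarithmic derivative of an Euler product. Each [f] is weighted by its
    degree, expanded over the prime powers [p ^+ i] dividing it; writing [f = p ^+ i * h] splits off
    the factor [Omega_wt w d ^+ i]. *)
Lemma Omega_sum_rec w j :
  j%:R * Omega_sum w j = \sum_(1 <= d < j.+1) \sum_(1 <= i < j.+1 | (d * i <= j)%N)
    (d * size (primes_deg F d))%:R * Omega_wt w d ^+ i * Omega_sum w (j - d * i).
Proof.
transitivity (\sum_(f <- monics F j) \sum_(1 <= d < j.+1)
   \sum_(p <- primes_deg F d) \sum_(1 <= i < j.+1)
     d%:R * (p ^+ i %| f)%R%:R * w ^+ Omega f).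
  rewrite /Omega_sum mulr_sumr; apply: eq_big_seq => f fj.
  have := fj; rewrite mem_monics => /andP[fm /eqP sf].
  have := @sum_mult _ j f fm; rewrite sf leqnn => /(_ isT) /= {1}<-.
  rewrite natr_sum mulr_suml; apply: eq_bigr => d _.
  rewrite natr_sum mulr_suml; apply: eq_bigr => p _.
  rewrite (mult_monics p fj) natrM natr_sum mulr_sumr mulr_suml.
  by apply: eq_bigr.
rewrite exchange_big /=; apply: eq_bigr => d _.
rewrite exchange_big /=.
transitivity (\sum_(p <- primes_deg F d) \sum_(1 <= i < j.+1 | (d * i <= j)%N)
   d%:R * Omega_wt w d ^+ i * Omega_sum w (j - d * i)); last first.
  rewrite big_const_seq count_predT iter_addr_0 -[LHS]mulr_natl mulr_sumr.
  by apply: eq_bigr => i _; rewrite natrM -!mulrA mulrCA.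
apply: eq_big_seq => p pd; have /mem_primes_deg[ip pm sp] := pd.
rewrite exchange_big /= [RHS]big_mkcond /=; apply: eq_bigr => i _.
have pim : p ^+ i \in monics F (d * i).
  rewrite mem_monics monic_exp //=.
  by rewrite -(@prednK (size (p ^+ i))) ?size_exp ?sp // size_poly_gt0 expf_neq0 // monic_neq0.
rewrite (eq_bigr (fun f => if p ^+ i %| f then d%:R * w ^+ Omega f else 0)); last first.
  by move=> f _; case: ifP => _; rewrite ?mulr1 ?mulr0 ?mul0r.
rewrite -big_mkcond; have [le_j|lt_j] := leqP; last first.
  exact: monics_dvd0 pim lt_j.
rewrite (sum_monics_dvd _ pim le_j) /Omega_sum mulr_sumr.
apply: eq_big_seq => h; rewrite mem_monics => /andP[hm _].
rewrite OmegaM ?expf_neq0 ?monic_neq0 // OmegaX ?monic_neq0 // (Omega_irred pd).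
rewrite exprD mulrA; congr (_ * _ * _); rewrite /Omega_wt.
by case: ifP => _; rewrite ?muln1 ?muln0 ?expr0 ?expr1n.
Qed.

Lemma Omega_sum1 j : Omega_sum 1 j = #|F|%:R ^+ j.
Proof.
rewrite /Omega_sum (eq_bigr (fun=> 1)) => [|f _]; last exact: expr1n.
by rewrite big_const_seq count_predT iter_addr_0 size_monics natrX.
Qed.

Lemma Omega_sum0 w : Omega_sum w 0 = 1.
Proof.
rewrite /Omega_sum (_ : monics F 0 = [:: 1]) ?big_seq1 ?Omega1 //.
apply/perm_small_eq/uniq_perm; rewrite ?uniq_monics ?size_monics ?expn0 //= => f.
rewrite mem_monics inE; apply/andP/eqP => [[fm /eqP sf]|->].
  by apply/eqP; rewrite -eqp_monic ?monic1 // -size_poly_eq1 sf.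
by rewrite monic1 size_poly1.
Qed.

Lemma Omega_sum_ge0 w j : 0 <= w -> 0 <= Omega_sum w j.
Proof. by move=> w0; apply: sumr_ge0 => f _; apply: exprn_ge0. Qed.

Lemma Omega_sum_le1 w j : 0 <= w <= 1 -> Omega_sum w j <= #|F|%:R ^+ j.
Proof.
move=> /andP[w0 w1]; rewrite -Omega_sum1; apply: ler_sum => f _.
by rewrite expr1n exprn_ile1.
Qed.

End Omega.

Lemma sum_group_mul (R : realFieldType) (c : nat -> R) (G : nat -> R) j :
  \sum_(1 <= d < j.+1) \sum_(1 <= i < j.+1 | (d * i <= j)%N) c d * G (d * i)%N =
  \sum_(1 <= m < j.+1)
     (\sum_(1 <= d < m.+1) \sum_(1 <= i < m.+1 | (d * i == m)%N) c d) * G m.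
Proof.
transitivity (\sum_(1 <= m < j.+1) \sum_(1 <= d < j.+1) \sum_(1 <= i < j.+1)
   if (d * i == m)%N then c d * G m else 0); last first.
  rewrite [LHS]big_nat [RHS]big_nat; apply: eq_bigr => m /andP[m0 le_mj].
  rewrite mulr_suml [RHS](big_nat_widen _ m.+1 j.+1) //= [RHS]big_mkcond /=.
  rewrite [LHS]big_nat [RHS]big_nat; apply: eq_bigr => d /andP[d0 _].
  rewrite mulr_suml [X in if _ then X else _](big_nat_widen _ m.+1 j.+1) //=.
  rewrite -big_mkcond; case: ifPn => le_dm.
    rewrite big_nat_cond [RHS]big_nat_cond; apply: eq_bigl => i.
    have [/andP[i0 _]|//] := boolP (1 <= i < j.+1)%N; rewrite /=.
    have [<-|//] := eqVneq; rewrite ltnS leq_pmull //.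
  rewrite big_nat_cond big1 // => i /andP[/andP[i0 _] /eqP e].
  by move: le_dm; rewrite -e ltnS leq_pmulr.
rewrite [RHS]exchange_big /= big_nat [RHS]big_nat; apply: eq_bigr => d /andP[d0 _].
rewrite [RHS]exchange_big /= big_mkcond /= [LHS]big_nat [RHS]big_nat.
apply: eq_bigr => i /andP[i0 _].
rewrite -big_mkcond; case: ifPn => di.
  have -> : c d * G (d * i)%N = \sum_(1 <= m < j.+1 | m == (d * i)%N) c d * G m.
    rewrite big_nat1_eq ltnS di muln_gt0 d0 i0 //.
  by apply: eq_bigl => m; rewrite eq_sym.
rewrite big_nat_cond big1 // => m /andP[/andP[_ le_mj] /eqP e].
by move: di; rewrite e -ltnS le_mj.
Qed.

(* Comparing [Omega_sum_rec] at [w = 1], where the sums are powers of [#|F|], in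
   degree [m] and below gives the count of primes without any field theory. *)
Lemma sum_primes_deg (R : realFieldType) (F : finFieldType) m : (0 < m)%N ->
  \sum_(1 <= d < m.+1) \sum_(1 <= i < m.+1 | (d * i == m)%N)
     (d * size (primes_deg F d))%:R = (#|F|%:R ^+ m : R).
Proof.
elim/ltn_ind: m => m IH m0.
have := @Omega_sum_rec F 1 0 R 1 m.
rewrite Omega_sum1 (eq_bigr (fun d => \sum_(1 <= i < m.+1 | (d * i <= m)%N)
   (d * size (primes_deg F d))%:R * #|F|%:R ^+ (m - (d * i)%N))); last first.
  move=> d _; apply: eq_bigr => i _.
  by rewrite Omega_sum1 /Omega_wt if_same expr1n mulr1.
rewrite (sum_group_mul (fun d => (d * size (primes_deg F d))%:R)
   (fun k => #|F|%:R ^+ (m - k))).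
rewrite big_nat_recr //= subnn expr0 mulr1.
(* By induction each of the [m - 1] terms below the top one equals [#|F| ^ m], so the top one is the
   last of the [m] copies on the left. *)
rewrite (eq_big_nat _ _ (F2 := fun=> #|F|%:R ^+ m)); last first.
  move=> k /andP[k0 lt_km]; rewrite IH // -exprD subnKC // ltnW //.
rewrite sumr_const_nat subn1 -[X in _ = X + _]mulr_natl.
rewrite -[X in X%:R * _](prednK m0) -natr1 mulrDl mul1r.
by move/addrI => <-.
Qed.

(** * Sequences controlled by their partial sums *)

Section Growth.
Variable R : realType.
Implicit Types (w x K : R) (s u : nat -> R).

(** Equivalent to [1 + w / x] being at most the [w]-th power of [x / (x - 1)], whose logarithm
    [- w * ln (1 - 1 / x)] is at least [w / x]. *)
Lemma powR_step w x : 0 <= w -> 1 < x -> (1 + w / x) * (x - 1) `^ w <= x `^ w.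
Proof.
move=> w0 x1; have x0 : 0 < x by lra.
have x10 : 0 < x - 1 by lra.
have -> : x `^ w = (x / (x - 1)) `^ w * (x - 1) `^ w.
  rewrite -powRM ?divr_ge0 ?ltW // divfK // gt_eqF //.
rewrite ler_wpM2r ?powR_ge0 // /powR gt_eqF ?divr_gt0 //.
apply: le_trans (expR_ge1Dx _); rewrite lerD2l; apply: ler_wpM2l => //.
have -> : x / (x - 1) = (1 + - x^-1)^-1 by field; rewrite !gt_eqF.
have xV : x^-1 < 1 by rewrite invf_lt1.
rewrite lnV ?posrE; last by lra.
by rewrite lerNr; apply: le_ln1Dx; lra.
Qed.

(** A discrete Gronwall inequality: the product of the factors [1 + w / i] telescopes through
    [powR_step]. It starts from [u 2] because that step needs [1 < x]. *)
Lemma powR_growth w u k : 0 <= w -> (forall j, 0 <= u j) ->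
  (forall j, (1 <= j <= k)%N -> u j.+1 <= u j * (1 + w / j%:R)) ->
  forall j, (1 <= j <= k)%N -> u j.+1 <= u 2%N * j%:R `^ w.
Proof.
move=> w0 u0 ustep; elim=> // -[|j] IH /andP[_ lek]; first by rewrite powR1 mulr1.
apply: (le_trans (ustep _ _)); first by rewrite lek.
have /IH h : (1 <= j.+1 <= k)%N by rewrite (ltnW lek).
apply: (@le_trans _ _ (u 2%N * j.+1%:R `^ w * (1 + w / j.+2%:R))).
  by rewrite ler_wpM2r // addr_ge0 ?divr_ge0.
rewrite -mulrA ler_wpM2l // mulrC.
have := @powR_step w j.+2%:R w0.
have -> : j.+2%:R - 1 = j.+1%:R :> R by rewrite -[j.+2%:R]natr1 addrK.
by apply; rewrite ltr1n.
Qed.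

Lemma natr_powR_le (j k : nat) w : 0 <= w -> (j <= k)%N -> j%:R `^ w <= k%:R `^ w :> R.
Proof. by move=> w0 le_jk; apply: ge0_ler_powR; rewrite // ?nnegrE ?ler_nat. Qed.

Definition psum s j := \sum_(0 <= i < j) s i.

Lemma psumS s j : psum s j.+1 = psum s j + s j.
Proof. by rewrite /psum big_nat_recr. Qed.

(* Past [k] the second recursion keeps [psum s j / j] close to its value at [k],
   because [\sum_j k / (j * (j + 1)) <= 1]; the factor [3 / 8 < 1] closes the bound. *)
Lemma psum_rec_upper s k :
  (0 < k)%N -> s 0%N = 1 -> (forall j, 0 <= s j) ->
  (forall j, (1 <= j)%N -> j%:R * s j <= 11 / 8 * psum s j) ->
  (forall j K, (k < j)%N -> (forall i, (i < j)%N -> s i <= K) ->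
      j%:R * s j <= psum s j + 3 / 8 * k%:R * K) ->
  forall j, s j <= 8 * k%:R `^ (3 / 8).
Proof.
move=> k0 s0 s_ge0 small large.
have kR : (0 : R) < k%:R by rewrite ltr0n.
have ps_ge0 j : 0 <= psum s j by apply: sumr_ge0.
have ps1 : psum s 1 = 1 by rewrite /psum big_nat1.
have s1 : s 1%N <= 11 / 8 by have := small 1%N isT; rewrite ps1 mul1r mulr1.
have ps2 : psum s 2 <= 19 / 8 by rewrite psumS ps1; lra.
(* By [small], each step multiplies [psum s] by at most [1 + (11 / 8) / j]. *)
have gr : forall j, (1 <= j)%N -> psum s j.+1 <= 19 / 8 * j%:R `^ (11 / 8).
  move=> j j1; apply: (@le_trans _ _ (psum s 2 * j%:R `^ (11 / 8))); last first.
    by rewrite ler_wpM2r ?powR_ge0.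
  apply: (@powR_growth _ (psum s) j) => [|//||]; [by lra| |by rewrite j1 leqnn].
  move=> i /andP[i1 _]; have iR : (0 : R) < i%:R by rewrite ltr0n.
  rewrite psumS mulrDr mulr1 lerD2l mulrA ler_pdivlMr //.
  by rewrite mulrC [_ * (11 / 8)]mulrC small.
have k1 : 1 <= k%:R `^ (3 / 8) :> R.
  have := @natr_powR_le 1 k (3 / 8); rewrite powR1; apply; [lra|done].
have gr' : forall j, (1 <= j <= k)%N -> psum s j <= 19 / 8 * k%:R `^ (3 / 8) * j%:R.
  case=> // -[_|j /andP[_ le_jk]]; first by rewrite ps1 mulr1; lra.
  apply: (le_trans (gr j.+1 isT)); rewrite -[X in _ <= X]mulrA ler_wpM2l //.
  apply: (@le_trans _ _ (j.+2%:R `^ (11 / 8))).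
    by apply: natr_powR_le => //; lra.
  rewrite (_ : 11 / 8 = 3 / 8 + 1); last by lra.
  rewrite powRD ?pnatr_eq0 ?implybT // powRr1 // ler_wpM2r //.
  by apply: natr_powR_le => //; lra.
move=> j; elim/ltn_ind: j => j IH; case: j IH => [_|j IH]; first by rewrite s0; lra.
have jR : (0 : R) < j.+1%:R by rewrite ltr0n.
have [le_jk|lt_kj] := leqP j.+1 k.
  rewrite -(ler_pM2l jR); apply: (le_trans (small j.+1 isT)).
  have := gr' j.+1; rewrite le_jk => /(_ isT) h.
  rewrite [X in _ <= X]mulrC; nra.
set K := 8 * _ in IH *.
have K0 : 0 <= K by rewrite mulr_ge0 ?powR_ge0.
(* The averages [psum s i / i] grow by at most [3 / 8 * K * k / (i * (i + 1))] per step, and the sum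
   of [k / (l * (l + 1))] over [k <= l < i] is exactly [1 - k / i]. *)
have avg i : (k <= i <= j.+1)%N ->
    psum s i <= 19 / 8 * k%:R `^ (3 / 8) * i%:R + 3 / 8 * K * (i%:R - k%:R).
  elim: i => [|i IHi]; first by rewrite leqn0 => /andP[/eqP k00]; move: k0; rewrite k00.
  rewrite leq_eqVlt => /andP[/predU1P[<- _|]].
    by rewrite subrr mulr0 addr0 gr' // k0 leqnn.
  rewrite ltnS => le_ki lt_ij; have := IHi; rewrite le_ki (ltnW lt_ij) => /(_ isT) {IHi}.
  have i0 : (0 < i)%N by apply: leq_trans le_ki.
  have iR : (0 : R) < i%:R by rewrite ltr0n.
  have : i%:R * s i <= psum s i + 3 / 8 * k%:R * K.
    have [<-|] := eqVneq k i; last first.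
      move=> nki; apply: large => [|l lt_li]; first by rewrite ltn_neqAle nki.
      by apply: IH; apply: ltn_trans lt_li _.
    apply: (le_trans (small _ k0)).
    have := gr' k; rewrite k0 leqnn => /(_ isT).
    rewrite /K; have := kR; move: (k%:R) (k%:R `^ _) (psum s k) k1 => x y p; nra.
  rewrite psumS -[i.+1%:R]natr1 => h1 h2; rewrite -(ler_pM2l iR).
  have : 0 <= i%:R + 1 :> R by lra.
  move=> /ler_wpM2l /(_ _ _ h2); move: h1.
  move: (K) (i%:R) (k%:R) (k%:R `^ _) (psum s i) (s i) => L x y a p t.
  lra.
(* The terms linear in [k] cancel, leaving [19 / 8 + 3 <= 8] times the power of [k]. *)
have h1 := avg j.+1; rewrite (ltnW lt_kj) leqnn in h1.
have h2 := large _ _ lt_kj IH.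
rewrite -(ler_pM2l jR); apply: (le_trans h2); move: (h1 isT); rewrite /K.
move: (j.+1%:R) (k%:R) (k%:R `^ _) (psum s _) jR k1 => x y a p.
nra.
Qed.

(** Up to [k], the first recursion makes [psum s + 4 / 3 * c0] grow at most like [j] to the power
    [3 / 4], the shift absorbing [c0]; so the average of the first [k] terms has order [k] to the
    power [- 1 / 4]. From then on each term is at most the average of its predecessors, so the
    averages never increase. [C] depends only on [c0]. *)
Lemma psum_rec_lower c0 : 0 <= c0 -> exists2 C : R, 0 <= C & forall s k,
  (0 < k)%N -> (forall j, 0 <= s j <= 1) ->
  (forall j, (1 <= j <= k)%N -> j%:R * s j <= 3 / 4 * psum s j + c0) ->
  (forall j, (1 <= j)%N -> j%:R * s j <= psum s j) ->
  forall j, (k <= j)%N -> s j <= C * k%:R `^ (- (1 / 4)).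
Proof.
move=> c00; exists (2 + 4 / 3 * c0) => [|s k k0 s01 small large]; first by lra.
have kR : (0 : R) < k%:R by rewrite ltr0n.
have s_ge0 j : 0 <= s j by case/andP: (s01 j).
have s_le1 j : s j <= 1 by case/andP: (s01 j).
have ps_ge0 j : 0 <= psum s j by apply: sumr_ge0.
pose u j := psum s j + 4 / 3 * c0.
have ps1 : psum s 1 = s 0%N by rewrite /psum big_nat1.
have u2 : u 2%N <= 2 + 4 / 3 * c0.
  rewrite /u psumS ps1 lerD2r; apply: (le_trans (lerD (s_le1 0%N) (s_le1 1%N))).
  by rewrite -natr1.
have gr j : (1 <= j <= k)%N -> u j.+1 <= (2 + 4 / 3 * c0) * j%:R `^ (3 / 4).
  move=> /andP[j1 le_jk]; apply: (@le_trans _ _ (u 2%N * j%:R `^ (3 / 4))); last first.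
    by rewrite ler_wpM2r ?powR_ge0.
  apply: (@powR_growth _ u k); [by lra| | |by rewrite j1].
    by move=> i; rewrite addr_ge0 // mulr_ge0.
  move=> i /andP[i1 le_ik]; have iR : (0 : R) < i%:R by rewrite ltr0n.
  rewrite /u psumS mulrDr mulr1 addrAC lerD2l mulrA ler_pdivlMr //.
  have := small i; rewrite i1 le_ik => /(_ isT); lra.
have psk : psum s k <= (2 + 4 / 3 * c0) * k%:R `^ (- (1 / 4)) * k%:R.
  rewrite -[X in _ <= X]mulrA -[X in _ <= _ * (_ * X)]powRr1 // -powRD; last first.
    by rewrite pnatr_eq0 -lt0n k0 implybT.
  rewrite (_ : - (1 / 4) + 1 = 3 / 4); last by lra.
  case: k k0 {small kR} gr => // -[|k] _ gr.
    by rewrite ps1 powR1 mulr1; have := s_le1 0%N; lra.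
  have h := gr k.+1; rewrite /= ltnW // in h.
  have {h} := h isT; rewrite /u => h.
  apply: (@le_trans _ _ ((2 + 4 / 3 * c0) * k.+1%:R `^ (3 / 4))); first by lra.
  by rewrite ler_wpM2l ?natr_powR_le //; lra.
move=> j le_kj; have jR : (0 : R) < j%:R by rewrite ltr0n (leq_trans k0).
have avg i : (k <= i)%N -> psum s i <= (2 + 4 / 3 * c0) * k%:R `^ (- (1 / 4)) * i%:R.
  elim: i => [|i IHi]; first by rewrite leqn0 => /eqP k00; move: k0; rewrite k00.
  rewrite leq_eqVlt => /predU1P[<- //|]; rewrite ltnS => le_ki.
  have i0 : (0 < i)%N by apply: leq_trans le_ki.
  have iR : (0 : R) < i%:R by rewrite ltr0n.
  have := IHi le_ki; have := large i i0.
  rewrite psumS -[i.+1%:R]natr1 => h1 h2; rewrite -(ler_pM2l iR).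
  have : 0 <= i%:R + 1 :> R by lra.
  move=> /ler_wpM2l /(_ _ _ h2); move: h1.
  move: (i%:R) (_ * k%:R `^ _) (psum s i) (s i) => x a p t.
  lra.
have h1 := avg j le_kj; have h2 := large j (leq_trans k0 le_kj).
by rewrite -(ler_pM2l jR) (le_trans h2) // mulrC.
Qed.

End Growth.

(** * Mean values over monic polynomials *)

Lemma geometric_le (R : realFieldType) (r : R) a n : 0 <= r < 1 ->
  \sum_(a <= i < n) r ^+ i <= r ^+ a / (1 - r).
Proof.
move=> /andP[r0 r1]; have r10 : 0 < 1 - r by rewrite subr_gt0.
have h m : 0 <= r ^+ m by apply: exprn_ge0.
have [le_na|/ltnW le_an] := leqP n a; first by rewrite big_geq // divr_ge0 // ltW.
suff -> : \sum_(a <= i < n) r ^+ i = (r ^+ a - r ^+ n) / (1 - r).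
  by rewrite ler_pM2r ?invr_gt0 // gerBl.
elim: n le_an => [|n IH].
  by rewrite leqn0 => /eqP->; rewrite big_geq // subrr mul0r.
rewrite leq_eqVlt => /predU1P[<-|]; first by rewrite big_geq // subrr mul0r.
rewrite ltnS => le_an; rewrite big_nat_recr //= IH // exprS.
by field; rewrite gt_eqF.
Qed.

Lemma geometric_half (R : realFieldType) a n :
  \sum_(a <= i < n) (1 / 2 : R) ^+ i <= 2 * (1 / 2) ^+ a.
Proof.
have := @geometric_le R (1 / 2) a n; rewrite [2 * _]mulrC.
have -> : 1 - 1 / 2 = 2^-1 :> R by field.
rewrite invrK; apply; apply/andP; split; lra.
Qed.

Section Mean.
Variables (R : realType) (F : finFieldType) (hi : nat).
Let q : R := #|F|%:R.
Let N d := size (primes_deg F d).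
Let c d i : R := (d * N d)%:R / q ^+ (d * i).

Definition Omega_mean lo w j : R := Omega_sum F lo hi w j / q ^+ j.

Lemma card_field_ge2 : 2 <= q.
Proof.
rewrite ler_nat; have := max_card [set (0 : F); 1].
by rewrite cards2 eq_sym oner_eq0.
Qed.

Lemma card_field_gt0 : 0 < q. Proof. by apply: lt_le_trans card_field_ge2. Qed.

Lemma primes_deg_le d : (0 < d)%N -> (d * N d)%:R <= q ^+ d.
Proof.
move=> d0; rewrite -(sum_primes_deg R F d0) big_nat_recr //=.
rewrite -[X in X <= _]add0r lerD ?sumr_ge0 // => [e _|]; first exact: sumr_ge0.
rewrite big_mkcond (bigD1_seq 1%N) ?iota_uniq ?mem_index_iota ?ltnS //= muln1 eqxx.
by rewrite lerDl sumr_ge0 // => i _; case: ifP.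
Qed.

Lemma coef_ge0 d i : 0 <= c d i.
Proof. by rewrite divr_ge0 // exprn_ge0 // ltW // card_field_gt0. Qed.

Lemma coef_le d i : (0 < d)%N -> (0 < i)%N -> c d i <= (1 / 2) ^+ (d * (i - 1)).
Proof.
move=> d0 i0; rewrite ler_pdivrMr ?exprn_gt0 ?card_field_gt0 //.
apply: (le_trans (primes_deg_le d0)).
rewrite -{2}(subnK i0) mulnDr muln1 exprD mulrA ler_peMl ?exprn_ge0 ?(ltW card_field_gt0) //.
by rewrite -exprMn exprn_ege1 // div1r mulrC ler_pdivlMr // mul1r card_field_ge2.
Qed.

Lemma Omega_mean0 lo w : Omega_mean lo w 0 = 1.
Proof. by rewrite /Omega_mean Omega_sum0 expr0 divr1. Qed.

Lemma Omega_mean_ge0 lo w j : 0 <= w -> 0 <= Omega_mean lo w j.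
Proof.
by move=> w0; rewrite divr_ge0 ?Omega_sum_ge0 // exprn_ge0 // ltW // card_field_gt0.
Qed.

Lemma Omega_mean_le1 lo w j : 0 <= w <= 1 -> Omega_mean lo w j <= 1.
Proof.
move=> w01; rewrite ler_pdivrMr ?exprn_gt0 ?card_field_gt0 // mul1r.
exact: Omega_sum_le1.
Qed.

Lemma psum_rev (s : nat -> R) j : \sum_(1 <= m < j.+1) s (j - m)%N = psum s j.
Proof.
rewrite big_add1 /= /psum [RHS]big_nat_rev /= add0n.
by apply: eq_bigr => m _.
Qed.

(** The prime count gives the pairs with [d * i = m] total weight 1. *)
Lemma psum_group_mul (s : nat -> R) j :
  \sum_(1 <= d < j.+1) \sum_(1 <= i < j.+1 | (d * i <= j)%N) c d i * s (j - d * i)%N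
  = psum s j.
Proof.
rewrite -psum_rev.
transitivity (\sum_(1 <= d < j.+1) \sum_(1 <= i < j.+1 | (d * i <= j)%N)
   (d * N d)%:R * (s (j - d * i)%N / q ^+ (d * i))).
  by apply: eq_bigr => d _; apply: eq_bigr => i _; rewrite /c mulrAC mulrA.
rewrite (sum_group_mul (fun d => (d * N d)%:R) (fun m => s (j - m)%N / q ^+ m)).
rewrite [LHS]big_nat [RHS]big_nat; apply: eq_bigr => m /andP[m0 _].
by rewrite sum_primes_deg // mulrC divfK // expf_neq0 // gt_eqF // card_field_gt0.
Qed.

(** With all weights replaced by 1 the recursion gives [psum s]. What is left carries a factor
    [Omega_wt lo hi w d ^+ i - 1], which vanishes for degrees outside the range of [Omega]. *)
Lemma Omega_mean_rec lo w j : let s := Omega_mean lo w in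
  j%:R * s j = psum s j + \sum_(1 <= d < j.+1) \sum_(1 <= i < j.+1 | (d * i <= j)%N)
     c d i * (Omega_wt lo hi w d ^+ i - 1) * s (j - d * i)%N.
Proof.
move=> s; rewrite -psum_group_mul -big_split /= {1}/s /Omega_mean mulrA Omega_sum_rec.
rewrite mulr_suml; apply: eq_bigr => d _.
rewrite mulr_suml -big_split; apply: eq_bigr => i le_j.
rewrite /= -mulrDl -[X in (X + _) * _]mulr1 -mulrDr addrC subrK.
have -> : q ^- j = q ^- (d * i) * q ^- (j - d * i) by rewrite -invfM -exprD subnKC.
rewrite /c /s /Omega_mean -/(N d); ring.
Qed.


(* The lower cutoff 8 makes the prime powers [p ^+ i], [2 <= i], negligible: their
   total weight is at most 1 / 24, so that [4 / 3 + 1 / 24 <= 11 / 8]. *)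
Lemma Omega_mean_upper_term M (s : nat -> R) j d : (1 <= d < j.+1)%N -> 0 <= M ->
  (forall i, 0 <= s i) -> (forall i, (i < j)%N -> s i <= M) ->
  \sum_(1 <= i < j.+1 | (d * i <= j)%N)
     c d i * (Omega_wt 8 hi (4 / 3) d ^+ i - 1) * s (j - d * i)%N
  <= (if (d <= hi)%N then 1 / 3 * s (j - d)%N else 0) +
     (if (8 <= d)%N then 32 / 9 * M * (1 / 2) ^+ d else 0).
Proof.
move=> /andP[d0 le_dj] M0 s0 sM.
have h m : 0 <= (1 / 2 : R) ^+ m by apply: exprn_ge0.
have rhs1 : 0 <= (if (d <= hi)%N then 1 / 3 * s (j - d)%N else 0).
  by case: ifP => // _; rewrite mulr_ge0.
have rhs2 : 0 <= (if (8 <= d)%N then 32 / 9 * M * (1 / 2) ^+ d else 0).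
  by case: ifP => // _; rewrite mulr_ge0 // mulr_ge0.
rewrite /Omega_wt; case: ifPn => [/andP[d8 dhi]|_]; last first.
  rewrite big1 ?addr_ge0 // => i _.
  by rewrite expr1n subrr mulr0 mul0r.
rewrite d8 dhi big_mkcond big_ltn; last by apply: leq_ltn_trans le_dj.
rewrite muln1 expr1 -ltnS le_dj; apply: lerD.
  rewrite (_ : 4 / 3 - 1 = 1 / 3); last by lra.
  rewrite ler_wpM2r // -[X in _ <= X]mul1r ler_wpM2r //.
  by have := @coef_le d 1 d0 isT; rewrite subnn muln0 expr0.
(* For [i >= 2], [coef_le] leaves [(1 / 2) ^+ d * (4 / 3) ^+ 2] times the [(i - 2)]-th power of
   [(1 / 2) ^+ d * (4 / 3)], which is at most [1 / 2] as [8 <= d]; and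
   [4 * (4 / 3) ^+ 2 = 64 / 9]. *)
apply: (@le_trans _ _ (\sum_(2 <= i < j.+1) (64 / 9 * M * (1 / 2) ^+ d) * (1 / 2) ^+ i)).
  rewrite big_nat [X in _ <= X]big_nat; apply: ler_sum => i /andP[i2 _].
  case: ifP => di; last by rewrite !mulr_ge0.
  have i0 : (0 < i)%N by apply: ltnW.
  apply: (@le_trans _ _ ((1 / 2) ^+ (d * (i - 1)) * (4 / 3) ^+ i * M)).
    have z1 : 1 <= (4 / 3 : R) ^+ i by apply: exprn_ege1; lra.
    apply: ler_pM => //; first by rewrite mulr_ge0 ?coef_ge0 ?subr_ge0.
      apply: ler_pM; rewrite ?coef_ge0 ?subr_ge0 ?coef_le //; lra.
    by apply: sM; rewrite ltn_subrL muln_gt0 d0 i0 /= (leq_trans d0).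
  case: i i2 {i0 di} => [|[|i]] // _.
  have -> : ((i.+2 - 1)%N = i.+1) by lia.
  rewrite mulnS exprD exprM !exprS.
  have : ((1 / 2) ^+ d) ^+ i * (4 / 3) ^+ i <= (1 / 2 : R) ^+ i.
    rewrite -exprMn; apply: lerXn2r; rewrite ?nnegrE ?mulr_ge0 //.
    have : (1 / 2 : R) ^+ d <= (1 / 2) ^+ 8.
      by rewrite -(subnKC d8) exprD ler_piMr // exprn_ile1 //; lra.
    rewrite !exprS expr0; move: ((1/2)^+d) => x; lra.
  move=> /(ler_wpM2l (mulr_ge0 (h d) M0)).
  move: ((1 / 2) ^+ d) (_ ^+ i) ((4/3) ^+ i) ((1/2) ^+ i) => x y u v; lra.
rewrite -mulr_sumr.
apply: (le_trans (ler_wpM2l _ (geometric_half R 2 j.+1))); first by rewrite !mulr_ge0.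
by rewrite expr2; move: ((1 / 2) ^+ d) => x; lra.
Qed.

Lemma Omega_mean_upper_step M j : let s := Omega_mean 8 (4 / 3) in
  (0 < j)%N -> 0 <= M -> (forall i, (i < j)%N -> s i <= M) ->
  j%:R * s j <= psum s j + 1 / 3 * (\sum_(1 <= d < j.+1 | (d <= hi)%N) s (j - d)%N)
                + 1 / 24 * M.
Proof.
move=> s j0 M0 sM; rewrite /s Omega_mean_rec -/s -addrA lerD2l.
have s0 i : 0 <= s i by apply: Omega_mean_ge0; lra.
apply: (@le_trans _ _ (\sum_(1 <= d < j.+1)
   ((if (d <= hi)%N then 1 / 3 * s (j - d)%N else 0) +
     (if (8 <= d)%N then 32 / 9 * M * (1 / 2) ^+ d else 0)))).
  by rewrite big_nat [X in _ <= X]big_nat; apply: ler_sum => d dj; apply: Omega_mean_upper_term.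
rewrite big_split /= -!big_mkcond mulr_sumr lerD2l -mulr_sumr.
have -> : \sum_(1 <= d < j.+1 | (8 <= d)%N) (1 / 2) ^+ d =
          \sum_(8 <= d < j.+1) (1 / 2 : R) ^+ d.
  by rewrite (big_nat_widenl 8 1).
(* [32 / 9 * 2 * (1 / 2) ^+ 8 = 1 / 36], which is below [1 / 24]. *)
apply: (le_trans (ler_wpM2l _ (geometric_half R 8 j.+1))); first by rewrite mulr_ge0.
rewrite !exprS expr0; lra.
Qed.

(** [Omega_mean_upper_step] is used in two ways. With [M = psum s i], which bounds every earlier
    term, the factors add up to [1 + 1 / 3 + 1 / 24 = 11 / 8]. With a bound [K] on the earlier terms
    and [hi < i], the middle sum has [hi] terms, and [1 / 3 * hi + 1 / 24 <= 3 / 8 * hi]. *)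
Lemma Omega_mean_upper j : (0 < hi)%N ->
  Omega_mean 8 (4 / 3) j <= 8 * hi%:R `^ (3 / 8).
Proof.
move=> hi0; apply: psum_rec_upper => //.
- exact: Omega_mean0.
- by move=> i; apply: Omega_mean_ge0; lra.
- move=> i i0; set s := Omega_mean _ _.
  have s0 l : 0 <= s l by apply: Omega_mean_ge0; lra.
  have ps0 : 0 <= psum s i by apply: sumr_ge0.
  have h := @Omega_mean_upper_step (psum s i) i i0 ps0.
  have {h} := h _; rewrite -/s => h.
  have le1 : \sum_(1 <= d < i.+1 | (d <= hi)%N) s (i - d)%N <= psum s i.
    rewrite -psum_rev big_mkcond; apply: ler_sum => d _; by case: ifP.
  have {}h := h _; apply: (le_trans (h _)); last by lra.
  move=> l lt_li; rewrite /psum (bigD1_seq l) ?iota_uniq ?mem_index_iota //=.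
  by rewrite lerDl sumr_ge0.
move=> i K lt_i sK; set s := Omega_mean _ _ in sK *.
have s0 l : 0 <= s l by apply: Omega_mean_ge0; lra.
have i0 : (0 < i)%N by apply: leq_ltn_trans lt_i.
have K0 : 0 <= K by apply: le_trans (sK 0%N i0).
apply: (le_trans (Omega_mean_upper_step i0 K0 sK)); rewrite -addrA lerD2l -/s.
have : \sum_(1 <= d < i.+1 | (d <= hi)%N) s (i - d)%N <= hi%:R * K.
  apply: (@le_trans _ _ (\sum_(1 <= d < hi.+1) K)).
    rewrite [X in _ <= X](big_nat_widen _ hi.+1 i.+1) ?ltnS ?(ltnW lt_i) //=.
    rewrite big_nat_cond [X in _ <= X]big_nat_cond; apply: ler_sum => d.
    by move=> /andP[/andP[d0 _] _]; apply: sK; rewrite ltn_subrL d0 i0.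
  by rewrite sumr_const_nat subn1 /= mulr_natl.
have : 1 <= hi%:R :> R by rewrite ler1n.
move: (\sum_(_ <= _ < _ | _) _) (hi%:R) => x y y1; nra.
Qed.

Lemma Omega_mean_lower_step j :
  j%:R * Omega_mean 8 (3 / 4) j <= psum (Omega_mean 8 (3 / 4)) j.
Proof.
set s := Omega_mean _ _; rewrite /s Omega_mean_rec -/s gerDl.
apply: sumr_le0 => d _; apply: sumr_le0 => i _.
rewrite mulr_le0_ge0 ?Omega_mean_ge0 ?mulr_ge0_le0 ?coef_ge0 ?subr_le0 //.
by rewrite /Omega_wt; case: ifP => _; rewrite ?expr1n // exprn_ile1 //; lra.
Qed.

(** For [j <= hi] every degree [d >= 8] that occurs is weighted, with [(3 / 4) ^+ i - 1 <= - 1 / 4].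
    The at most seven degrees below 8 miss this saving, at a cost of at most [1 / 2] each, whence
    the constant 4. *)
Lemma Omega_mean_lower_step_small j : let s := Omega_mean 8 (3 / 4) in (j <= hi)%N ->
  j%:R * s j <= 3 / 4 * psum s j + 4.
Proof.
move=> s le_jhi; have s01 i : 0 <= s i <= 1.
  by apply/andP; split; [apply: Omega_mean_ge0|apply: Omega_mean_le1; apply/andP; split]; lra.
have h m : 0 <= (1 / 2 : R) ^+ m by apply: exprn_ge0.
rewrite /s Omega_mean_rec -/s.
suff le4 : \sum_(1 <= d < j.+1) \sum_(1 <= i < j.+1 | (d * i <= j)%N)
      c d i * (Omega_wt 8 hi (3 / 4) d ^+ i - 1) * s (j - d * i)%N
    <= - (1 / 4) * psum s j + \sum_(1 <= d < j.+1) if (d < 8)%N then 1 / 2 else 0.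
  have : \sum_(1 <= d < j.+1) (if (d < 8)%N then 1 / 2 else 0) <= 4 :> R.
    have [le_j8|lt_8j] := leqP j.+1 8.
      apply: (@le_trans _ _ (\sum_(1 <= d < j.+1) (1 / 2))).
        by apply: ler_sum => d _; case: ifP => // _; lra.
      rewrite sumr_const_nat subn1 -mulr_natl /=.
      have : j%:R <= 7%:R :> R by rewrite ler_nat.
      lra.
    rewrite -big_mkcond -(@big_nat_widen _ _ _ 1 8 j.+1 xpredT) ?(ltnW lt_8j) //=.
    by rewrite sumr_const_nat subn1 -mulr_natl /=; lra.
  move=> le4'; apply: (le_trans (lerD (lexx _) le4)); move: le4'.
  by move: (bigop _ _ _) (psum s j) => y p; lra.
rewrite -psum_group_mul mulr_sumr -big_split [X in X <= _]big_nat [X in _ <= X]big_nat.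
apply: ler_sum => d /andP[d0 le_dj] /=.
case: ltnP => d8; last first.
  rewrite addr0 mulr_sumr big_nat_cond [X in _ <= X]big_nat_cond.
  apply: ler_sum => i /andP[/andP[i0 _] di]; rewrite [X in _ <= X]mulrA ler_wpM2r //.
    by case/andP: (s01 (j - d * i)%N).
  rewrite mulrC ler_wpM2r ?coef_ge0 // /Omega_wt d8 /= (leq_trans _ le_jhi) //.
  rewrite -(prednK i0) exprS; have : (3 / 4 : R) ^+ i.-1 <= 1 by rewrite exprn_ile1 //; lra.
  by move: (_ ^+ _) => x; lra.
rewrite big1 => [|i _]; last by rewrite /Omega_wt leqNgt d8 /= expr1n subrr mulr0 mul0r.
set S := \sum_(_ <= _ < _ | _) _.
suff : S <= 2 by move: (S) => x; lra.
apply: (@le_trans _ _ (\sum_(1 <= i < j.+1) 2 * (1 / 2) ^+ i)).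
  rewrite /S big_mkcond big_nat [X in _ <= X]big_nat; apply: ler_sum => i /andP[i0 _].
  case: ifP => _; last by rewrite mulr_ge0.
  have /andP[si0 si1] := s01 (j - d * i)%N.
  apply: (@le_trans _ _ (c d i * 1)); first by rewrite ler_wpM2l ?coef_ge0.
  rewrite mulr1 (le_trans (coef_le d0 i0)) // subn1 -{2}(prednK i0) exprS mulrA.
  rewrite (_ : 2 * (1 / 2) = 1) ?mul1r; last by lra.
  rewrite -(subnKC (leq_pmull i.-1 d0)) exprD ler_piMr // exprn_ile1 //; lra.
rewrite -mulr_sumr; apply: (le_trans (ler_wpM2l _ (geometric_half R 1 j.+1))) => //.
by rewrite expr1; lra.
Qed.

End Mean.

Lemma Omega_mean_lower (R : realType) : exists2 C : R, 0 <= C &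
  forall (F : finFieldType) hi j, (0 < hi)%N -> (hi <= j)%N ->
    Omega_mean F hi 8 (3 / 4) j <= C * hi%:R `^ (- (1 / 4)).
Proof.
have [//|C C0 HC] := @psum_rec_lower R 4; exists C => // F hi j hi0 le_j.
apply: HC le_j => // [i|i /andP[_ le_i]|i _].
- by apply/andP; split; [apply: Omega_mean_ge0|apply: Omega_mean_le1; apply/andP; split]; lra.
- exact: Omega_mean_lower_step_small.
- exact: Omega_mean_lower_step.
Qed.

(** * Matrices fixing a space *)

Lemma char_poly_conj (F : fieldType) n (h g : 'M[F]_n) : h \in unitmx ->
  char_poly (h *m g *m invmx h) = char_poly g.
Proof.
move=> hu; rewrite /char_poly.
have -> : char_poly_mx (h *m g *m invmx h) =
    map_mx polyC h *m char_poly_mx g *m map_mx polyC (invmx h).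
  rewrite /char_poly_mx mulmxBr mulmxBl -!map_mxM scalar_mxC.
  rewrite -['X%:M *m _ *m _]mulmxA -map_mxM.
  by rewrite mulmxV // map_mx1 mulmx1.
rewrite !det_mulmx mulrAC -det_mulmx -map_mxM mulmxV // map_mx1 det1 mul1r //.
Qed.

Lemma char_poly_lblock (F : fieldType) k m (A : 'M[F]_k) (B : 'M[F]_(m, k)) (D : 'M[F]_m) :
  char_poly (block_mx A 0 B D) = char_poly A * char_poly D.
Proof.
rewrite /char_poly /char_poly_mx map_block_mx scalar_mx_block opp_block_mx add_block_mx.
by rewrite map_mx0 oppr0 addr0 det_lblock.
Qed.

Section Fixing.
Variables (R : realFieldType) (F : finFieldType).

(* As in [derangement_on_spaces], but for [n] itself rather than [n.-1.+1]. *)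
Definition fixes_space n k (g : 'M[F]_n) : bool :=
  [exists U : 'M[F]_n, (\rank U == k) && stablemx U g].

Lemma sum_conj n (f : 'M[F]_n -> R) h : h \in unitmx ->
  \sum_(g in unitmx) f (h *m g *m invmx h) = \sum_(g in unitmx) f g.
Proof.
move=> hu; have hVu : invmx h \in unitmx by rewrite unitmx_inv.
rewrite [RHS](reindex (fun g => h *m g *m invmx h)) /=; last first.
  exists (fun g => invmx h *m g *m h) => g _.
    by rewrite -!mulmxA mulVmx // mulmx1 mulmxA mulVmx // mul1mx.
  by rewrite -!mulmxA mulmxV // mulmx1 mulmxA mulmxV // mul1mx.
by apply: eq_bigl => g; rewrite !unitmx_mul hu hVu andbT.
Qed.

Section Parabolic.
Variables k m : nat.
Local Notation n := (k + m)%N.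
Let stdU : 'M[F]_(k, n) := row_mx 1%:M 0.

Lemma std_space_free : row_free stdU.
Proof.
by apply/row_freeP; exists (col_mx 1%:M 0); rewrite mul_row_col mulmx1 mul0mx addr0.
Qed.

Lemma stable_std_space (g : 'M[F]_n) : stablemx stdU g = (ursubmx g == 0).
Proof.
have e : stdU *m g = row_mx (ulsubmx g) (ursubmx g).
  by rewrite -{1}[g]submxK mul_row_block !mul1mx !mul0mx !addr0.
rewrite e; apply/idP/eqP => [/submxP[D]|->].
  by rewrite mul_mx_row mulmx1 mulmx0 => /eq_row_mx[_ ->].
by apply/submxP; exists (ulsubmx g); rewrite mul_mx_row mulmx1 mulmx0.
Qed.

Lemma stable_conj (g h : 'M[F]_n) : h \in unitmx ->
  stablemx (stdU *m h) g = stablemx stdU (h *m g *m invmx h).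
Proof.
move=> hu; rewrite -[RHS](@submxMfree _ _ _ _ _ _ _ h) ?row_free_unit //.
by rewrite -!mulmxA mulVmx // mulmx1.
Qed.

(** If [h0] carries the standard space to a fixed space [U], then so does [p *m h0] for every [p] in
    the stabiliser of the standard space, and these are distinct. *)
Lemma count_conj_stable (g : 'M[F]_n) : g \in unitmx -> fixes_space k g ->
  (#|[set p : 'M[F]_n | (p \in unitmx) && stablemx stdU p]|
   <= #|[set h : 'M[F]_n | (h \in unitmx) && stablemx (stdU *m h) g]|)%N.
Proof.
move=> gu /existsP[U /andP[/eqP rU stU]].
have [h0 h0u eh0] : {h : 'M[F]_n | h \in unitmx & (stdU *m h :=: U)%MS}.
  pose B : 'M[F]_(k, n) := castmx (rU, erefl) (row_base U).
  have Bf : row_free B by rewrite row_free_castmx row_base_free.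
  have [|h hu eh] := @complete_unitmx F _ _ stdU (pinvmx stdU *m B).
    by rewrite mulmxA mulmxVp ?std_space_free // mul1mx (eqP Bf) (eqP std_space_free).
  exists h => //; rewrite -eh mulmxA mulmxVp ?std_space_free // mul1mx.
  apply: (eqmx_trans (eqmx_cast _ _)); exact: eq_row_base.
rewrite -(card_imset _ (can_inj (mulmxK h0u))).
apply/subset_leq_card/fintype.subsetP => _ /imsetP[p /[!inE] /andP[pu stp] ->].
rewrite unitmx_mul pu h0u /=.
have ep : (stdU *m p :=: stdU)%MS.
  apply/eqmxP; rewrite stp /= -(geq_leqif (mxrank_leqif_sup stp)).
  by rewrite mxrankMfree // row_free_unit.
by rewrite mulmxA (eqmx_stable _ (eqmx_trans (eqmxMr h0 ep) eh0)).
Qed.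

(** Double counting of the pairs [(g, h)] such that [g] fixes [stdU *m h]: [count_conj_stable]
    bounds the number of [h] from below for each [g] that fixes some k-space, while for each [h]
    conjugation moves the sum over [g] to the stabiliser of [stdU]. *)
Lemma sum_fixes_le (y : 'M[F]_n -> R) : (forall g, 0 <= y g) ->
  (forall h g, h \in unitmx -> y (h *m g *m invmx h) = y g) ->
  #|[set p : 'M[F]_n | (p \in unitmx) && stablemx stdU p]|%:R *
    (\sum_(g in unitmx | fixes_space k g) y g)
  <= #|[set g : 'M[F]_n | g \in unitmx]|%:R *
     \sum_(p in unitmx | stablemx stdU p) y p.
Proof.
move=> y0 yconj.
apply: (@le_trans _ _ (\sum_(g in unitmx) \sum_(h in unitmx | stablemx (stdU *m h) g) y g)).
  rewrite mulr_sumr big_mkcondr; apply: ler_sum => g gu; case: ifP => fg; last first.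
    exact: sumr_ge0.
  rewrite sumr_const -[X in _ <= X]mulr_natl ler_wpM2r // ler_nat.
  by apply: leq_trans (count_conj_stable gu fg) _; rewrite cardsE.
rewrite (exchange_big_dep (mem unitmx)) /=; last by move=> g h _ /andP[].
rewrite mulr_natl -sumr_const; rewrite le_eqVlt; apply/orP; left; apply/eqP.
rewrite [RHS](eq_bigl (mem unitmx)); last by move=> h; rewrite inE.
apply: eq_bigr => h hu.
rewrite (eq_bigl (fun g => (g \in unitmx) && stablemx stdU (h *m g *m invmx h))); last first.
  by move=> g; rewrite hu stable_conj.
rewrite !big_mkcondr -[RHS](@sum_conj n _ h hu).
by apply: eq_bigr => g _; rewrite yconj.
Qed.

Lemma sum_stable (f : 'M[F]_n -> R) :
  \sum_(p in unitmx | stablemx stdU p) f p =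
  \sum_(A : 'M[F]_k | A \in unitmx) \sum_(D : 'M[F]_m | D \in unitmx) \sum_(B : 'M[F]_(m, k))
     f (block_mx A 0 B D).
Proof.
rewrite pair_big /= pair_big /=.
rewrite (reindex_onto (fun t => block_mx t.1.1 0 t.2 t.1.2)
  (fun p : 'M[F]_n => (ulsubmx p, drsubmx p, dlsubmx p))) /=; last first.
  by move=> p /andP[_]; rewrite stable_std_space => /eqP {1}<-; rewrite submxK.
apply: eq_bigl => -[[A D] B] /=.
rewrite stable_std_space block_mxKul block_mxKur block_mxKdl block_mxKdr !eqxx !andbT.
by rewrite !unitmxE det_lblock unitrM.
Qed.

Lemma card_stable :
  #|[set p : 'M[F]_n | (p \in unitmx) && stablemx stdU p]|%:R =
  #|[set A : 'M[F]_k | A \in unitmx]|%:R * #|[set D : 'M[F]_m | D \in unitmx]|%:R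
   * #|F|%:R ^+ (m * k) :> R.
Proof.
rewrite cardsE -(sumr_const _ (1 : R)) sum_stable.
rewrite (eq_bigr (fun=> #|[set D : 'M[F]_m | D \in unitmx]|%:R * #|F|%:R ^+ (m * k))).
  by rewrite sumr_const -[LHS]mulr_natl !cardsE mulrA.
move=> A _; rewrite (eq_bigr (fun=> #|F|%:R ^+ (m * k))).
  by rewrite sumr_const -[LHS]mulr_natl !cardsE.
by move=> D _; rewrite sumr_const card_mx natrX.
Qed.

End Parabolic.

Definition GL_mean n (f : 'M[F]_n -> R) : R :=
  (\sum_(g in unitmx) f g) / #|[set g : 'M[F]_n | g \in unitmx]|%:R.

Lemma card_unitmx_gt0 n : 0 < #|[set g : 'M[F]_n | g \in unitmx]|%:R :> R.
Proof. by rewrite ltr0n; apply/card_gt0P; exists 1%:M; rewrite inE unitmx1. Qed.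

Lemma fixes_space_le k m lo hi (w l : R) : 0 < w -> 0 < l ->
  #|[set g : 'M[F]_(k + m) | (g \in unitmx) && fixes_space k g]|%:R /
    #|[set g : 'M[F]_(k + m) | g \in unitmx]|%:R <=
  l^-1 * GL_mean (fun g : 'M[F]_(k + m) => w ^+ Omega lo hi (char_poly g)) +
  l * (GL_mean (fun g : 'M[F]_k => w^-1 ^+ Omega lo hi (char_poly g)) *
       GL_mean (fun g : 'M[F]_m => w^-1 ^+ Omega lo hi (char_poly g))).
Proof.
move=> w0 l0.
pose W n (g : 'M[F]_n) := w ^+ Omega lo hi (char_poly g).
pose V n (g : 'M[F]_n) := w^-1 ^+ Omega lo hi (char_poly g).
have W0 n g : 0 < W n g by exact: exprn_gt0.
have V0 n g : 0 < V n g by apply: exprn_gt0; rewrite invr_gt0.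
have WV n g : V n g = (W n g)^-1 by rewrite /V exprVn.
have VM A B D : V _ (block_mx A 0 B D : 'M[F]_(k + m)) = V _ A * V _ D.
  by rewrite /V char_poly_lblock OmegaM ?exprD // monic_neq0 // char_poly_monic.
have Vconj h (g : 'M[F]_(k + m)) : h \in unitmx -> V _ (h *m g *m invmx h) = V _ g.
  by move=> hu; rewrite /V char_poly_conj.
rewrite -/(W _) -/(V _).
have := sum_fixes_le (fun g => ltW (V0 _ g)) Vconj.
rewrite card_stable sum_stable.
have -> : \sum_(A : 'M[F]_k | A \in unitmx) \sum_(D : 'M[F]_m | D \in unitmx)
     \sum_(B : 'M[F]_(m, k)) V _ (block_mx A 0 B D : 'M[F]_(k + m)) =
   (\sum_(A in unitmx) V k A) * (\sum_(D in unitmx) V m D) * #|F|%:R ^+ (m * k).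
  rewrite !mulr_suml; apply: eq_bigr => A _.
  rewrite mulr_sumr mulr_suml; apply: eq_bigr => D _.
  rewrite (eq_bigr (fun=> V _ A * V _ D)) => [|B _]; last exact: VM.
  by rewrite sumr_const card_mx -[LHS]mulr_natr natrX.
rewrite /GL_mean.
have an := card_unitmx_gt0 (k + m); have ak := card_unitmx_gt0 k.
have am := card_unitmx_gt0 m.
have q0 : 0 < #|F|%:R ^+ (m * k) :> R.
  by apply: exprn_gt0; rewrite ltr0n; apply/card_gt0P; exists 0.
have le1 : #|[set g : 'M[F]_(k + m) | (g \in unitmx) && fixes_space k g]|%:R <=
   l^-1 * (\sum_(g in unitmx) W (k + m)%N g) +
   l * \sum_(g in unitmx | fixes_space k g) V (k + m)%N g.
  rewrite cardsE -(sumr_const _ (1 : R)) !mulr_sumr.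
  apply: (@le_trans _ _ (\sum_(g in unitmx | fixes_space k g)
      (l^-1 * W (k + m)%N g + l * V (k + m)%N g))).
    apply: ler_sum => g _; rewrite WV.
    (* One of the two terms alone is at least 1, according to whether [W] reaches [l]. *)
    have [le_lW|lt_Wl] := leP l (W _ g).
      by rewrite -[1]addr0 lerD ?ler_pdivlMl ?mulr1 // mulr_ge0 ?invr_ge0 ?ltW.
    by rewrite -[1]add0r lerD ?ler_pdivlMr ?mul1r ?mulr_ge0 ?invr_ge0 // ltW.
  rewrite big_split lerD2r big_mkcondr; apply: ler_sum => g _.
  by case: ifP => // _; rewrite mulr_ge0 ?invr_ge0 // ltW.
move: le1 an ak am q0.
move: (\sum_(g in _ | _) _) (\sum_(g in _) W _ _) (\sum_(g in _) V k _) (\sum_(g in _) V m _).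
move=> S1 S2 S3 S4.
move: (_%:R) (_%:R) (_%:R) (_%:R) (_ ^+ _) => am ak an N Q le1 an0 ak0 am0 Q0 le2.
(* The [Q] choices of the off-diagonal block cancel against the order of the stabiliser. *)
have le3 : S1 <= an * (S3 / ak * (S4 / am)).
  have -> : an * (S3 / ak * (S4 / am)) = an * (S3 * S4 * Q) / (ak * am * Q).
    by field; rewrite !gt_eqF.
  by rewrite ler_pdivlMr ?mulr_gt0 // mulrC.
rewrite ler_pdivrMr //; apply: (le_trans le1).
rewrite mulrDl lerD //; first by rewrite mulrA divfK // gt_eqF.
by rewrite -[X in _ <= X]mulrA ler_wpM2l ?(ltW l0) // [X in _ <= X]mulrC.
Qed.
End Fixing.

(** * Annihilators of vectors *)

Section Krylov.
Variables (F : finFieldType) (n' : nat).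
Local Notation n := n'.+1.
Implicit Types (g h : 'M[F]_n) (v : 'rV[F]_n) (f r : {poly F}).

Definition krylov j v g : 'M[F]_(j, n) := \matrix_(i < j) (v *m g ^+ i).

Lemma mul_krylov j v g (u : 'rV[F]_j) :
  u *m krylov j v g = v *m horner_mx g (rVpoly u).
Proof.
rewrite mulmx_sum_row /rVpoly poly_def raddf_sum mulmx_sumr; apply: eq_bigr => i _.
by rewrite valK /= horner_mxZ rmorphXn /= horner_mx_X rowK scalemxAr.
Qed.

(** Row-freeness says that no nonzero polynomial of degree below [j] kills [v], so a monic [f] of
    degree [j] is the minimal polynomial of [v] under [g]. *)
Definition is_ann j f g v : bool :=
  (v *m horner_mx g f == 0) && row_free (krylov j v g).

Lemma horner_mx_modp f g v r : v *m horner_mx g f = 0 ->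
  v *m horner_mx g (r %% f) = v *m horner_mx g r.
Proof.
move=> vf; rewrite [in RHS](divp_eq r f) mulrC rmorphD rmorphM /= mulmxDr mulmxA vf.
by rewrite mul0mx add0r.
Qed.

Lemma krylov_free_eq0 j g v r : row_free (krylov j v g) -> (size r <= j)%N ->
  v *m horner_mx g r = 0 -> r = 0.
Proof.
move=> Kf sr; rewrite -(poly_rV_K sr) -mul_krylov => /eqP.
by rewrite -(mul0mx _ (krylov j v g)) => /eqP /(row_free_inj Kf) ->; rewrite linear0.
Qed.

(** Cayley-Hamilton bounds the least degree [j] of a monic polynomial that kills [v]; a dependence
    among the first [j] Krylov rows, made monic, would have smaller degree. *)
Lemma ann_exists g v : exists j f, [/\ (j <= n)%N, f \in monics F j & is_ann j f g v].
Proof.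
pose P j := has (fun f => v *m horner_mx g f == 0) (monics F j).
have exP : exists j, P j.
  exists n; apply/hasP; exists (char_poly g).
    by rewrite mem_monics char_poly_monic size_char_poly eqxx.
  by rewrite Cayley_Hamilton mulmx0.
have [j /hasP[f fj vf] jmin] := ex_minnP exP.
exists j, f; split=> //.
  apply: jmin; apply/hasP; exists (char_poly g).
    by rewrite mem_monics char_poly_monic size_char_poly eqxx.
  by rewrite Cayley_Hamilton mulmx0.
rewrite /is_ann vf /=; apply: inj_row_free => u; rewrite mul_krylov => vu.
apply: contraTeq isT => u0; set r := rVpoly u in vu.
have r0 : r != 0 by apply: contra u0 => /eqP r0; rewrite -[u]rVpolyK -/r r0 linear0.
have sr : (size r <= j)%N by apply: size_poly.
have lc0 : lead_coef r != 0 by rewrite lead_coef_eq0.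
have /jmin : P (size r).-1.
  apply/hasP; exists ((lead_coef r)^-1 *: r).
    rewrite mem_monics monicE lead_coefZ mulVf // eqxx size_scale ?invr_eq0 //.
    by rewrite prednK ?size_poly_gt0 ?eqxx.
  by rewrite horner_mxZ -scalemxAr vu scaler0.
by move: r0 sr; rewrite -size_poly_gt0; move: (size r) => x; lia.
Qed.

Lemma ann_dvd_char j f g v : f \in monics F j -> is_ann j f g v -> f %| char_poly g.
Proof.
rewrite mem_monics => /andP[fm /eqP sf] /andP[/eqP vf Kf].
apply/modp_eq0P; apply: (krylov_free_eq0 Kf).
  by rewrite -ltnS -sf ltn_modp monic_neq0.
by rewrite horner_mx_modp // Cayley_Hamilton mulmx0.
Qed.

(* The matrix on the right is the companion matrix of [f]. *)
Lemma krylov_companion j f g v : f \in monics F j -> v *m horner_mx g f = 0 ->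
  krylov j v g *m g = (\matrix_(i < j) poly_rV ('X^(i.+1) %% f)) *m krylov j v g.
Proof.
rewrite mem_monics => /andP[fm /eqP sf] vf; apply/row_matrixP => i.
rewrite !row_mul !rowK mul_krylov poly_rV_K; last by rewrite -ltnS -sf ltn_modp monic_neq0.
by rewrite horner_mx_modp // rmorphXn /= horner_mx_X exprSr mulmxA.
Qed.

Lemma krylov_vec_inj j f g v v' : f \in monics F j -> v *m horner_mx g f = 0 ->
  v' *m horner_mx g f = 0 -> krylov j v g = krylov j v' g -> v = v'.
Proof.
case: j => [|j] fj vf v'f.
  (* For [j = 0] the Krylov matrix is empty, but then [f = 1] and both vectors are 0. *)
  move: fj; rewrite mem_monics => /andP[fm /eqP sf].
  have f1 : f = 1 by apply/eqP; rewrite -eqp_monic ?monic1 // -size_poly_eq1 sf.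
  by move: vf v'f; rewrite f1 rmorph1 !mulmx1 => -> ->.
by move=> /(congr1 (row ord0)); rewrite !rowK expr0 !mulmx1.
Qed.

(* Any two pairs (g0, v0) and (g, v) of this kind have Krylov matrices B0 and
   B0 *m h for some unit h, and then h *m g *m invmx h agrees with g0 on B0: double
   counting the pairs (h, g) cancels the stabiliser of B0. *)
Lemma card_ann_le j f : f \in monics F j ->
  (#|[set t : 'M[F]_n * 'rV[F]_n | (t.1 \in unitmx) && is_ann j f t.1 t.2]|
   <= #|[set g : 'M[F]_n | g \in unitmx]|)%N.
Proof.
move=> fj; set X := [set t | _].
have [->|[[g0 v0]]] := set_0Vmem X; first by rewrite cards0.
rewrite inE /= => /andP[g0u /andP[/eqP vf0 B0f]].
set B0 := krylov j v0 g0 in B0f.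
pose S := [set p : 'M[F]_n | (p \in unitmx) && (B0 *m p == B0)].
have S0 : (0 < #|S|)%N by apply/card_gt0P; exists 1%:M; rewrite inE unitmx1 mulmx1 eqxx.
pose H (t : 'M[F]_n * 'rV[F]_n) := 
  [set h : 'M[F]_n | (h \in unitmx) && (B0 *m h == krylov j t.2 t.1)].
have leH t : t \in X -> (#|S| <= #|H t|)%N.
  case: t => g v; rewrite inE /= => /andP[gu /andP[vf Bf]].
  have [|h hu eh] := @complete_unitmx F _ _ B0 (pinvmx B0 *m krylov j v g).
    by rewrite mulmxA mulmxVp // mul1mx (eqP Bf) (eqP B0f).
  rewrite mulmxA mulmxVp // mul1mx in eh.
  rewrite -(card_imset _ (can_inj (mulmxK hu))).
  apply/subset_leq_card/fintype.subsetP => _ /imsetP[p /[!inE] /andP[pu /eqP stp] ->].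
  by rewrite unitmx_mul pu hu /= mulmxA stp eh.
pose Y := [set t : 'M[F]_n * 'M[F]_n | [&& t.1 \in unitmx, t.2 \in unitmx &
   B0 *m (t.1 *m t.2 *m invmx t.1) == B0 *m g0]].
have le1 : (#|X| * #|S| <= #|Y|)%N.
  pose Z := [set z : ('M[F]_n * 'rV[F]_n) * 'M[F]_n | (z.1 \in X) && (z.2 \in H z.1)].
  apply: (@leq_trans #|Z|).
    rewrite -sum_nat_const -[#|Z|]sum1_card; under [X in (_ <= X)%N]eq_bigl do rewrite inE.
    rewrite -(@pair_big_dep _ _ _ _ _ (mem X) (fun t h => h \in H t) (fun _ _ => 1%N)) /=.
    by apply: leq_sum => t tX; rewrite sum1_card leH.
  (* Dropping [v] is injective on [Z]: [B0 *m h] is the Krylov matrix of [v] under [g] and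
     determines [v]. *)
  rewrite -(@card_in_imset _ _ (fun z => (z.2, z.1.1)) (mem Z)).
    apply/subset_leq_card/fintype.subsetP => _ /imsetP[[[g v] h] /[!inE] /= zZ ->] /=.
    case/andP: zZ => /andP[gu /andP[/eqP vf _]] /andP[hu /eqP B0h].
    rewrite gu hu /= !mulmxA B0h (krylov_companion fj vf) -B0h !mulmxA mulmxK //.
    by rewrite (krylov_companion fj vf0).
  move=> [[g v] h] [[g1 v1] h1] /[!inE] /= zZ zZ1 [eh eg]; subst g1 h1.
  case/andP: zZ => /andP[_ /andP[/eqP vf _]] /andP[_ /eqP e1].
  case/andP: zZ1 => /andP[_ /andP[/eqP vf1 _]] /andP[_ /eqP e2].
  by rewrite (krylov_vec_inj fj vf vf1) // -e1 -e2.
(* For [(h, g)] in [Y] the matrix [h *m g *m invmx h *m invmx g0] lies in [S], and together with [h]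
   it determines [g]. *)
have le2 : (#|Y| <= #|[set g : 'M[F]_n | g \in unitmx]| * #|S|)%N.
  rewrite -cardsX -(@card_in_imset _ _
    (fun t => (t.1, t.1 *m t.2 *m invmx t.1 *m invmx g0)) (mem Y)).
    apply/subset_leq_card/fintype.subsetP => _ /imsetP[[h g] /[!inE] /= /and3P[hu gu /eqP e] ->].
    rewrite /= !unitmx_mul !unitmx_inv hu gu g0u /= mulmxA e.
    by rewrite mulmxK.
  move=> [h g] [h1 g1] /[!inE] /= /and3P[hu gu _] /and3P[_ _ _] [eh].
  rewrite -eh; move/(can_inj (mulmxKV g0u))/(can_inj (mulmxKV hu)).
  by move/(can_inj (mulKmx hu)) => ->.
by rewrite -(leq_pmul2r S0) (leq_trans le1).
Qed.

End Krylov.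

(** * Means over GL_n in terms of monic polynomials *)

Section Average.
Variables (R : realFieldType) (F : finFieldType) (n' lo hi : nat).
Local Notation n := n'.+1.

(** Averaging over all vectors [v], each [g] is charged to the annihilator [f] of [v]. The cofactor
    of [f] in the characteristic polynomial has degree [n - j], so it contributes at most
    [b ^+ (n - j)]; by [card_ann_le] each [f] serves at most a proportion [1 / #|F| ^ n] of the
    pairs [(g, v)]. *)
Lemma GL_mean_le (w b : R) : (0 < lo)%N -> 0 <= w <= b -> 1 <= b ->
  GL_mean (fun g : 'M[F]_n => w ^+ Omega lo hi (char_poly g)) <=
  \sum_(j < n.+1) (b / #|F|%:R) ^+ (n - j) * (Omega_sum F lo hi w j / #|F|%:R ^+ j).
Proof.
move=> lo0 /andP[w0 wb] b1.
have b0 : 0 <= b by apply: le_trans b1.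
have q0 : 0 < #|F|%:R :> R by rewrite ltr0n; apply/card_gt0P; exists 0.
have cu := card_unitmx_gt0 R F n.
have charW (g : 'M[F]_n) j f v : f \in monics F j -> is_ann j f g v ->
    w ^+ Omega lo hi (char_poly g) <= w ^+ Omega lo hi f * b ^+ (n - j).
  move=> fj av; have /dvdpP[h eh] := ann_dvd_char fj av.
  move: fj; rewrite mem_monics => /andP[fm /eqP sf].
  have cm := char_poly_monic g; rewrite eh monicMr // in cm.
  have sh : (size h).-1 = (n - j)%N.
    have := size_char_poly g; rewrite eh size_Mmonic ?monic_neq0 // sf.
    by move: (size h) => x; lia.
  rewrite eh mulrC OmegaM ?monic_neq0 // exprD ler_wpM2l ?exprn_ge0 // -sh.
  apply: (@le_trans _ _ (b ^+ Omega lo hi h)).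
    by apply: lerXn2r; rewrite ?nnegrE.
  by apply: ler_weXn2l => //; apply: Omega_le_deg.
rewrite ler_pdivrMr // -(ler_pM2r (exprn_gt0 n q0)).
apply: (@le_trans _ _ (\sum_(g : 'M[F]_n | g \in unitmx) \sum_(v : 'rV[F]_n)
   \sum_(j < n.+1) \sum_(f <- monics F j)
      (is_ann j f g v)%:R * (w ^+ Omega lo hi f * b ^+ (n - j)))).
  rewrite mulr_suml; apply: ler_sum => g _.
  apply: (@le_trans _ _ (\sum_(v : 'rV[F]_n) w ^+ Omega lo hi (char_poly g))).
    by rewrite sumr_const card_mx mul1n -[X in _ <= X]mulr_natr natrX.
  apply: ler_sum => v _.
  have [j [f [le_jn fj av]]] := ann_exists g v.
  have le_jn' : (j < n.+1)%N by [].
  have ge0 (i : nat) r : 0 <= (is_ann i r g v)%:R * (w ^+ Omega lo hi r * b ^+ (n - i)).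
    by rewrite !mulr_ge0 // exprn_ge0.
  rewrite (bigD1 (Ordinal le_jn')) //= (bigD1_seq f) ?uniq_monics //= av mul1r.
  rewrite -addrA; apply: (le_trans (charW _ _ _ _ fj av)); rewrite lerDl addr_ge0 //.
    exact: sumr_ge0.
  by apply: sumr_ge0 => i _; apply: sumr_ge0.
rewrite pair_big /= exchange_big /= !mulr_suml; apply: ler_sum => j _.
have qj : (b / #|F|%:R) ^+ (n - j) * (Omega_sum F lo hi w j / #|F|%:R ^+ j) *
    #|[set g : 'M[F]_n | g \in unitmx]|%:R * #|F|%:R ^+ n =
    Omega_sum F lo hi w j * b ^+ (n - j) * #|[set g : 'M[F]_n | g \in unitmx]|%:R.
  have -> : #|F|%:R ^+ n = #|F|%:R ^+ (n - j) * #|F|%:R ^+ j :> R.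
    by rewrite -exprD subnK // -ltnS.
  rewrite exprMn exprVn.
  by field; rewrite !expf_neq0 // gt_eqF.
rewrite qj exchange_big /= /Omega_sum !mulr_suml big_seq [X in _ <= X]big_seq.
apply: ler_sum => f fj; rewrite -mulr_suml mulrC ler_wpM2l ?mulr_ge0 ?exprn_ge0 //.
rewrite -natr_sum ler_nat.
apply: (leq_trans _ (card_ann_le n' fj)).
rewrite -sum1_card [X in (_ <= X)%N](eq_bigl (fun t =>
  (t.1 \in unitmx) && is_ann j f t.1 t.2)); last by move=> t; rewrite inE.
rewrite [X in (_ <= X)%N]big_mkcondr big_mkcondr /=.
by apply: leq_sum => t _; case: (is_ann _ _ _ _).
Qed.
End Average.

(** * Derangements on spaces *)

Section Final.
Variable R : realType.

Lemma sum_ord_rev (f : nat -> R) n : \sum_(j < n.+1) f (n - j)%N = \sum_(0 <= i < n.+1) f i.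
Proof.
rewrite [RHS]big_nat_rev /= big_mkord; apply: eq_bigr => j _.
by rewrite add0n subSS.
Qed.

(** The ratio [b / #|F|] is at most [2 / 3] for [b = 4 / 3]; the geometric sum 3 multiplies the
    constant 8 of [Omega_mean_upper]. *)
Lemma GL_mean_upper (F : finFieldType) hi n : (0 < hi)%N -> (0 < n)%N ->
  GL_mean (fun g : 'M[F]_n => (4 / 3 : R) ^+ Omega 8 hi (char_poly g)) <=
  24 * hi%:R `^ (3 / 8).
Proof.
case: n => // n hi0 _; have q2 := card_field_ge2 R F; have q0 := card_field_gt0 R F.
apply: (le_trans (@GL_mean_le R F n 8 hi (4 / 3) (4 / 3) isT _ _)).
- by apply/andP; split; lra.
- lra.
set K := hi%:R `^ _; have K0 : 0 <= K by apply: powR_ge0.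
have r0 : 0 <= (4 / 3) / #|F|%:R :> R by rewrite divr_ge0 //; lra.
apply: (@le_trans _ _ (\sum_(j < n.+2) (2 / 3) ^+ (n.+1 - j) * (8 * K))).
  apply: ler_sum => j _; apply: ler_pM.
  - exact: exprn_ge0.
  - by apply: (@Omega_mean_ge0 R F hi 8 (4 / 3) j); lra.
  - apply: lerXn2r; rewrite ?nnegrE //; rewrite ler_pdivrMr //.
    by move: (#|F|%:R) q2 => x; lra.
  exact: (@Omega_mean_upper R F hi j hi0).
rewrite -mulr_suml (sum_ord_rev (fun i => (2 / 3) ^+ i)).
have : \sum_(0 <= i < n.+2) (2 / 3 : R) ^+ i <= 3.
  apply: (le_trans (geometric_le _ _ _)); first by apply/andP; split; lra.
  by rewrite expr0 (_ : 1 - 2 / 3 = 3^-1) ?invrK ?mul1r //; field.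
move: (bigop _ _ _) => x; nra.
Qed.

(** Degrees [j >= hi] fall under [Omega_mean_lower]. For [j < hi] the polynomial means are only
    known to be at most 1, but the factors [(1 / 2) ^+ (n - j)] sum to at most [2 * (1 / 2) ^+ hi]
    since [2 * hi <= n]. *)
Lemma GL_mean_lower : exists2 C : R, 0 <= C & forall (F : finFieldType) hi n,
  (0 < hi)%N -> (2 * hi <= n)%N ->
  GL_mean (fun g : 'M[F]_n => (3 / 4 : R) ^+ Omega 8 hi (char_poly g)) <=
  C * hi%:R `^ (- (1 / 4)).
Proof.
have [C C0 HC] := @Omega_mean_lower R.
exists (2 * C + 2) => [|F hi [|n] hi0 le_n]; [by lra|by lia|].
have q2 := card_field_ge2 R F; have q0 := card_field_gt0 R F.
apply: (le_trans (@GL_mean_le R F n 8 hi (3 / 4) 1 isT _ _)) => //.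
  by apply/andP; split; lra.
set K := hi%:R `^ _; have K0 : 0 <= K by apply: powR_ge0.
have h m : 0 <= (1 / 2 : R) ^+ m by apply: exprn_ge0.
have hiR : (0 : R) < hi%:R by rewrite ltr0n.
have r0 : 0 <= 1 / #|F|%:R :> R by rewrite divr_ge0.
apply: (@le_trans _ _ (\sum_(j < n.+2) ((1 / 2) ^+ (n.+1 - j) * (C * K) +
    (if (n.+1 - hi <= n.+1 - j)%N then (1 / 2) ^+ (n.+1 - j) else 0)))).
  apply: ler_sum => j _.
  apply: (@le_trans _ _ ((1 / 2) ^+ (n.+1 - j) * (Omega_mean F hi 8 (3 / 4) j))).
    apply: ler_wpM2r; first by apply: Omega_mean_ge0; lra.
    apply: lerXn2r; rewrite ?nnegrE //; rewrite ler_pdivrMr //.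
    by move: (#|F|%:R) q2 => x; lra.
  have [le_hj|lt_jh] := leqP hi j.
    apply: (@le_trans _ _ ((1 / 2) ^+ (n.+1 - j) * (C * K))).
      by rewrite ler_wpM2l // HC.
    by rewrite lerDl; case: ifP.
  rewrite leq_sub2l ?(ltnW lt_jh) // -[X in X <= _]add0r lerD ?mulr_ge0 //.
  rewrite -[X in _ <= X]mulr1 ler_wpM2l // Omega_mean_le1 //.
  by apply/andP; split; lra.
rewrite big_split /= -mulr_suml (sum_ord_rev (fun i => (1 / 2) ^+ i)).
rewrite (sum_ord_rev (fun i => if (n.+1 - hi <= i)%N then (1 / 2) ^+ i else 0)).
rewrite -big_mkcond /=.
have -> : \sum_(0 <= i < n.+2 | (n.+1 - hi <= i)%N) (1 / 2) ^+ i =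
          \sum_(n.+1 - hi <= i < n.+2) (1 / 2 : R) ^+ i.
  by rewrite (big_nat_widenl (n.+1 - hi) 0).
have s1 := geometric_half R 0 n.+2; have s2 := geometric_half R (n.+1 - hi) n.+2.
have s3 : (1 / 2) ^+ (n.+1 - hi) <= K.
  apply: (@le_trans _ _ ((1 / 2) ^+ hi)).
    have le : (hi <= n.+1 - hi)%N by lia.
    by rewrite -(subnKC le) exprD ler_piMr // exprn_ile1 //; lra.
  apply: (@le_trans _ _ hi%:R^-1).
    rewrite div1r exprVn lef_pV2 ?posrE ?exprn_gt0 //.
    by rewrite -natrX ler_nat ltnW // ltn_expl.
  rewrite -powR_inv1 ?(ltW hiR) // /K.
  apply: ler_powR; last by lra.
  by rewrite ler1n.
rewrite expr0 mulr1 in s1; have := ler_wpM2r (mulr_ge0 C0 K0) s1; move: s2 s3.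
move: (\sum_(0 <= i < _) _) (\sum_(_ <= i < _) _) ((1 / 2) ^+ _) => x y u; lra.
Qed.

Lemma fixes_space_bound : exists2 D : R, 0 <= D & forall (F : finFieldType) k m,
  (1 < k)%N -> (k <= m)%N ->
  #|[set g : 'M[F]_(k + m) | (g \in unitmx) && fixes_space k g]|%:R /
    #|[set g : 'M[F]_(k + m) | g \in unitmx]|%:R <= D / (k./2)%:R `^ (1 / 16) :> R.
Proof.
have [C C0 HC] := GL_mean_lower.
exists (24 + C ^+ 2) => [|F k m k1 le_km]; first by rewrite addr_ge0 // sqr_ge0.
set hi := k./2; have hi0 : (0 < hi)%N by rewrite /hi; lia.
have le_hk : (2 * hi <= k)%N by rewrite /hi; lia.
have hiR : (0 : R) < hi%:R by rewrite ltr0n.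
(* The exponent [7 / 16] balances the two terms: [3 / 8 - 7 / 16 = 7 / 16 - 2 / 4 = - 1 / 16]. *)
have l0 : 0 < hi%:R `^ (7 / 16) :> R by rewrite powR_gt0.
have w0 : 0 < 4 / 3 :> R by lra.
apply: (le_trans (@fixes_space_le R F k m 8 hi (4 / 3) _ w0 l0)).
have -> : (4 / 3)^-1 = 3 / 4 :> R by field.
have km0 : (0 < k + m)%N by lia.
have h1 := @GL_mean_upper F hi (k + m) hi0 km0.
have h2 := HC F hi k hi0 le_hk.
have h3 := HC F hi m hi0 (leq_trans le_hk le_km).
have GL0 n : 0 <= GL_mean (fun g : 'M[F]_n => (3 / 4 : R) ^+ Omega 8 hi (char_poly g)).
  by rewrite divr_ge0 // sumr_ge0 // => g _; rewrite exprn_ge0 //; lra.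
have nz : (hi%:R : R) != 0 by rewrite gt_eqF.
have e1 : (hi%:R `^ (7 / 16))^-1 * hi%:R `^ (3 / 8) = (hi%:R `^ (1 / 16))^-1 :> R.
  by rewrite -!powRN -powRD ?nz ?implybT //; congr (_ `^ _); lra.
have e2 : hi%:R `^ (7 / 16) * (hi%:R `^ (- (1 / 4)) * hi%:R `^ (- (1 / 4)))
     = (hi%:R `^ (1 / 16))^-1 :> R.
  by rewrite -!powRN -!powRD ?nz ?implybT //; congr (_ `^ _); lra.
rewrite [X in _ <= X]mulrDl; apply: lerD.
  rewrite -e1 [X in _ <= X]mulrCA; apply: ler_wpM2l => //; by rewrite invr_ge0 ltW.
have := ler_pM (GL0 k) (GL0 m) h2 h3.
move=> /(ler_wpM2l (ltW l0)) /le_trans; apply.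
by rewrite -e2 le_eqVlt; apply/orP; left; apply/eqP; ring.
Qed.


Lemma card_GL_pred (F : finFieldType) n (P : pred 'M[F]_n.-1.+1) :
  #|[set g : {'GL_n[F]} | P (GLval g)]| = #|[set g | (g \in unitmx) && P g]|.
Proof.
rewrite -(card_imset _ (@val_inj _ _ {'GL_n[F]})); apply: eq_card => g.
rewrite inE; apply/imsetP/andP => [[u /[!inE] Pu ->]|[gu Pg]].
  by split=> //; exact: GL_unit.
by exists (Sub g gu : {'GL_n[F]}); rewrite ?inE SubK.
Qed.

Lemma derangement_proportionE (F : finFieldType) n k :
  1 - derangement_proportion R F n k =
  #|[set g : 'M[F]_n.-1.+1 | (g \in unitmx) && fixes_space k g]|%:R /
  #|[set g : 'M[F]_n.-1.+1 | g \in unitmx]|%:R.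
Proof.
have eGL : #|('GL_n[F])%g| = #|[set g : 'M[F]_n.-1.+1 | g \in unitmx]|.
  transitivity #|[set g : {'GL_n[F]} | predT (GLval g)]|.
    by apply: eq_card => g; rewrite !inE.
  by rewrite card_GL_pred; apply: eq_card => g; rewrite !inE andbT.
rewrite /derangement_proportion eGL -card_GL_pred.
set c := #|[set g : {'GL_n[F]} | _]|; set b := #|[set g in unitmx]|.
set a := #|_|.
have e : b = (a + c)%N.
  rewrite /b -eGL /a /c -(cardsID [set g : {'GL_n[F]} | fixes_space k (GLval g)] 'GL_n[F]%g).
  rewrite addnC; congr (_ + _)%N; apply: eq_card => g; rewrite !inE //.
  rewrite andbT /fixes_space negb_exists /derangement_on_spaces.
  by apply: eq_forallb => U; rewrite negb_and implybE.
have b0 : b%:R != 0 :> R by rewrite gt_eqF // card_unitmx_gt0.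
by move: b0; rewrite e natrD => b0; field.
Qed.

(** The exponent is half of [1 / 100] because the final AM-GM step squares this power of [k]; it is
    far below the available [1 / 16]. *)
Lemma derangement_bound : exists2 C : R, 0 <= C & forall (F : finFieldType) n k,
  (1 <= k)%N -> (2 * k <= n)%N ->
  (1 - derangement_proportion R F n k) * k%:R `^ (1 / 200) <= C.
Proof.
have [D D0 HD] := fixes_space_bound.
exists (3 * D + 1) => [|F n k k0 le_kn]; first by lra.
have dp0 : 0 <= derangement_proportion R F n k by rewrite divr_ge0.
(* For [k = 1], where [k./2 = 0], nonnegativity of the proportion is enough. *)
case: k k0 le_kn dp0 => // -[|k] _ le_kn dp0; first by rewrite powR1; lra.
set K := k.+2; have [m em] : exists m, n.-1.+1 = (K + m)%N /\ (K <= m)%N.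
  by exists (n - K)%N; rewrite /K; lia.
have h : 1 - derangement_proportion R F n K <= D / (K./2)%:R `^ (1 / 16).
  rewrite derangement_proportionE; case: em => -> le_Km; exact: HD.
have hi1 : 1 <= (K./2)%:R :> R by rewrite ler1n /K.
have pw0 (x a : R) : 0 <= x `^ a by apply: powR_ge0.
(* This rests on [K <= 3 * K./2], valid since [K >= 2]. *)
have K2 : K%:R `^ (1 / 200) <= 3 * (K./2)%:R `^ (1 / 16) :> R.
  apply: (@le_trans _ _ (3 `^ (1 / 200) * (K./2)%:R `^ (1 / 200))).
    rewrite -powRM // -natrM; apply: natr_powR_le; first by lra.
    by rewrite /K; lia.
  apply: ler_pM => //.
    have := @ler_powR R 3 _ (1 / 200) 1; rewrite powRr1 //; apply; lra.
  by apply: ler_powR => //; lra.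
have p0 : 0 < (K./2)%:R `^ (1 / 16) :> R by rewrite powR_gt0 //; lra.
apply: (@le_trans _ _ (D / (K./2)%:R `^ (1 / 16) * K%:R `^ (1 / 200))).
  by rewrite ler_wpM2r.
apply: (@le_trans _ _ (D / (K./2)%:R `^ (1 / 16) * (3 * (K./2)%:R `^ (1 / 16)))).
  by rewrite ler_wpM2l // divr_ge0 // ltW.
rewrite (_ : _ * _ = 3 * D); first by lra.
by field; rewrite gt_eqF.
Qed.

End Final.

(** * From the uniform bound to the limit and the explicit estimate *)

Local Open Scope classical_set_scope.

Theorem theorem9p4 (R : realType) :
  (forall (F : finFieldType) (n k : nat -> nat),
     (forall i : nat, (1 <= k i)%N /\ (2 * k i <= n i)%N) ->
     k i @[i --> \oo] --> \oo ->
     derangement_proportion R F (n i) (k i) @[i --> \oo] --> (1 : R))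
  /\
  (exists A B : R,
     forall (F : finFieldType) (n k : nat),
       (1 <= k)%N -> (2 * k <= n)%N ->
       forall eps : R, 0 < eps -> B / Num.sqrt eps < k%:R ->
         1 - eps - A / (eps * (k%:R - B / Num.sqrt eps) `^ (1 / 100%:R))
           <= derangement_proportion R F n k).
Proof.
have [C C0 HC] := @derangement_bound R; split.
  move=> F n k nk k_oo.
  have le1 i : derangement_proportion R F (n i) (k i) <= 1.
    rewrite -subr_ge0 derangement_proportionE divr_ge0 //.
  apply/cvgrPdist_le => e e0.
  (* From [K] on, the power [1 / 200] of [k i] is at least [C / e], so the bound of
     [derangement_bound] drops to [e]. *)
  pose K := (Num.bound ((C / e) `^ 200)).+1.
  have : \forall i \near \oo, (K <= k i)%N by exact: (k_oo _ (nbhs_infty_ge K)).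
  apply: filterS => i le_Ki; have [k1 kn] := nk i.
  rewrite ger0_norm ?subr_ge0 //.
  have kR : 0 < (k i)%:R `^ (1 / 200) :> R by rewrite powR_gt0 // ltr0n.
  have h := HC F (n i) (k i) k1 kn.
  rewrite -(ler_pM2r kR) (le_trans h) // -ler_pdivrMl // mulrC.
  have Ce0 : 0 <= C / e by rewrite divr_ge0 // ltW.
  have -> : C / e = ((C / e) `^ 200) `^ (1 / 200).
    by rewrite -powRrM (_ : 200 * (1 / 200) = 1) ?powRr1 //; lra.
  apply: ge0_ler_powR; rewrite ?nnegrE ?powR_ge0 //.
  apply: le_trans (ltW (archi_boundP _)) _; rewrite ?powR_ge0 // ler_nat.
  by apply: leq_trans le_Ki.
exists (C ^+ 2), 0 => F n k k1 kn eps e0 _.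
rewrite mul0r subr0; have h := HC F n k k1 kn.
have kR : 0 < k%:R `^ (1 / 200) :> R by rewrite powR_gt0 // ltr0n.
have -> : k%:R `^ (1 / 100%:R) = (k%:R `^ (1 / 200)) ^+ 2 :> R.
  by rewrite -powR_mulrn ?powR_ge0 // -powRrM; congr (_ `^ _); field.
move: (derangement_proportion R F n k) (k%:R `^ (1 / 200)) h kR => d x h x0.
suff : 1 - d <= eps + C ^+ 2 / (eps * x ^+ 2) by lra.
apply: (@le_trans _ _ (C / x)); first by rewrite ler_pdivlMr.
have t0 : 0 <= C / x by rewrite divr_ge0 // ltW.
have -> : C ^+ 2 / (eps * x ^+ 2) = (C / x) ^+ 2 / eps.
  by field; rewrite !gt_eqF.
(* With [t = C / x] this becomes [t * eps <= eps ^+ 2 + t ^+ 2]. *)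
rewrite -(ler_pM2r e0) mulrDl divfK ?gt_eqF //.
by move: (C / x) t0 => t t0; nra.
Qed.
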